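(* Let $0<\varepsilon\le \frac14$ and $\alpha=2\tfrac14-\varepsilon=\tfrac94-\varepsilon$. Then for every $\delta>0$ there is $n_0$ such that for every $n\ge n_0$, every graph $G$ with $n$ vertices and average degree $\alpha$, and $\gamma$ defined by the condition that $G$ has exactly $\gamma n$ leaves, $$A(G)-a(\alpha)\ge \frac{2}{25}\left(\varepsilon-\frac{\gamma}{4}\right)-\delta$$ (that is, $A(G)-a(\alpha)\ge\frac{2}{25}(\varepsilon-\gamma/4)+o(1)$ as $n\to\infty$). In particular, the optimal such graph must contain at least $4\varepsilon n-o(n)$ leaves: if for each $n$ the graph $G_n$ minimises $A$ among all graphs with $n$ vertices and at most $\alpha n/2$ edges, then $G_n$ has at least $4\varepsilon n-o(n)$ leaves as $n\to\infty$.
   Context: A graph means a finite graph, possibly with multiple (parallel) edges; each edge is a unit resistor, and $R_{xy}$ denotes effective resistance ($R_{xx}=0$; $R_{xy}=\infty$ if $x,y$ lie in different components). $e(G)$ is the number of edges; a leaf is a vertex of degree $1$. For a graph $G$ on $n\ge2$ vertices, $A(G)=\frac{1}{\binom n2}\sum_{\{x,y\}}R_{xy}$, the sum over unordered pairs of distinct vertices, and $A'(G)=\frac{1}{n^2}\sum_{x,y\in V(G)}R_{xy}=\frac{n-1}{n}A(G)$. Following the paper's convention, a graph on $n$ vertices is said to have average degree $\alpha$ if $e(G)\le \alpha n/2$. Define $a_n(\alpha)=\min\{A'(G):|V(G)|=n,\ e(G)\le \alpha n/2\}$ and $a(\alpha)=\lim_{n\to\infty}a_n(\alpha)$ (the limit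 exists for $\alpha\ge2$). *)

(* Defs.v *)
From mathcomp Require Import all_boot all_order all_algebra.
From mathcomp Require Import all_classical all_reals all_analysis.
Set Implicit Arguments.
Unset Strict Implicit.
Unset Printing Implicit Defensive.
Import Order.TTheory GRing.Theory Num.Theory.
Import numFieldNormedType.Exports.

Local Open Scope classical_set_scope.
Local Open Scope ring_scope.

(* Loopless multigraphs on {0, ..., n-1}; [mult x y] is the number of parallel
   edges between [x] and [y]. *)
Record mgraph (n : nat) := MGraph {
  mult :> 'I_n -> 'I_n -> nat ;
  mult_sym : forall x y, mult x y = mult y x ;
  mult_irr : forall x, mult x x = 0%N }.

Definition nedges n (G : mgraph n) : nat :=
  (\sum_(x < n) \sum_(y < n | x < y) G x y)%N.

Definition degree n (G : mgraph n) (x : 'I_n) : nat := (\sum_(y < n) G x y)%N.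

Definition nleaves n (G : mgraph n) : nat := #|[set x | degree G x == 1%N]%SET|.

Definition adj n (G : mgraph n) : rel 'I_n := fun x y => (0 < G x y)%N.

(* By Ohm's law [G v w * (phi v - phi w)] is the current flowing from [v] to
   [w] when every edge is a unit resistor.  The condition is Kirchhoff's node
   law for a unit current entering at [x] and leaving at [y]. *)
Definition unit_potential (R : realType) n (G : mgraph n) (x y : 'I_n)
    (phi : 'I_n -> R) : Prop :=
  forall v, \sum_(w < n) (G v w)%:R * (phi v - phi w)
            = (v == x)%:R - (v == y)%:R.

(* When [x] and [y] are connected, a potential as above exists
   ([unit_potential_exists]) and [phi x - phi y] does not depend on its choice
   ([eff_resE]); the default value of [xget] is then irrelevant. *)
Definition eff_res (R : realType) n (G : mgraph n) (x y : 'I_n) : \bar R :=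
  if connect (adj G) x y then
    let phi := xget (fun=> 0) [set phi | unit_potential G x y phi] in
    (phi x - phi y)%:E
  else +oo%E.

Lemma harmonic_connect (R : realType) n (G : mgraph n) (h : 'I_n -> R) :
  (forall v, \sum_(w < n) (G v w)%:R * (h v - h w) = 0) ->
  forall x y, connect (adj G) x y -> h x = h y.
Proof.
move=> hh.
have S0 : \sum_(v < n) \sum_(w < n) (G v w)%:R * (h v * (h v - h w)) = 0.
  apply: big1 => v _.
  transitivity (h v * \sum_(w < n) (G v w)%:R * (h v - h w)).
    by rewrite mulr_sumr; apply: eq_bigr => w _; rewrite mulrCA.
  by rewrite hh mulr0.
have S1 : \sum_(v < n) \sum_(w < n) (G v w)%:R * (h v - h w) ^+ 2 = 0.
  transitivity (\sum_(v < n) \sum_(w < n) (G v w)%:R * (h v * (h v - h w))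
     + \sum_(v < n) \sum_(w < n) (G v w)%:R * (h w * (h w - h v))).
    rewrite -big_split; apply: eq_bigr => v _ /=; rewrite -big_split /=.
    apply: eq_bigr => w _ /=; rewrite -mulrDr; congr (_ * _).
    by rewrite expr2 mulrBl -[h w - h v]opprB mulrN.
  rewrite S0 add0r exchange_big /= -[RHS]S0.
  by apply: eq_bigr => v _; apply: eq_bigr => w _; rewrite mult_sym.
have p0 v w : 0 <= (G v w)%:R * (h v - h w) ^+ 2.
  by rewrite mulr_ge0 ?ler0n ?sqr_ge0.
have hadj v w : adj G v w -> h v = h w.
  move=> vw; have /eqP := S1.
  rewrite psumr_eq0; last by move=> i _; apply: sumr_ge0.
  move=> /allP/(_ v); rewrite mem_index_enum => /(_ isT)/=.
  rewrite psumr_eq0// => /allP/(_ w); rewrite mem_index_enum => /(_ isT)/=.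
  rewrite mulf_eq0 pnatr_eq0 sqrf_eq0 subr_eq0 => /orP[/eqP g0|/eqP //].
  by move: vw; rewrite /adj g0.
move=> x y /connectP[p + ->]; elim: p x => //= z p IH x /andP[xz zp].
by rewrite (hadj _ _ xz); apply: IH.
Qed.

Lemma unit_potential_exists (R : realType) n (G : mgraph n) (x y : 'I_n) : connect (adj G) x y ->
  exists phi : 'I_n -> R, unit_potential G x y phi.
Proof.
move=> cxy.
pose L : 'M[R]_n :=
  \matrix_(v, w) ((v == w)%:R * (\sum_(u < n) (G v u)%:R) - (G v w)%:R).
have LE (f : 'I_n -> R) v :
    \sum_w L v w * f w = \sum_w (G v w)%:R * (f v - f w).
  under eq_bigr do rewrite mxE mulrBl.
  under [RHS]eq_bigr do rewrite mulrBr.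
  rewrite !sumrB; congr (_ - _); rewrite (bigD1 v)//= eqxx mul1r.
  rewrite [X in _ + X]big1 ?addr0.
    by rewrite mulr_suml.
  by move=> w; rewrite eq_sym => /negbTE ->; rewrite !mul0r.
have Lsym v w : L v w = L w v.
  rewrite !mxE mult_sym eq_sym; case: eqVneq => [->|] //; by rewrite !mul0r.
pose b : 'rV[R]_n := \row_v ((v == x)%:R - (v == y)%:R).
have /submxP[f bf] : (b <= L)%MS.
  rewrite submxE; apply/eqP/rowP => j; rewrite !mxE.
  have cE : cokermx L x j = cokermx L y j.
    apply: (@harmonic_connect R n G (fun v => cokermx L v j)) cxy => v.
    rewrite -LE; have := mulmx_coker L => /matrixP/(_ v j).
    by rewrite !mxE.
  under eq_bigr do rewrite mxE mulrBl.
  rewrite sumrB (bigD1 x)//= eqxx mul1r big1 ?addr0; last first.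
    by move=> i /negbTE ->; rewrite mul0r.
  rewrite (bigD1 y)//= eqxx mul1r big1 ?addr0 ?cE ?subrr//.
  by move=> i /negbTE ->; rewrite mul0r.
exists (fun v => f 0 v) => v; rewrite -LE.
move/rowP: bf => /(_ v); rewrite !mxE => ->.
by apply: eq_bigr => w _; rewrite mulrC Lsym.
Qed.

Lemma eff_resE (R : realType) n (G : mgraph n) (x y : 'I_n) (phi : 'I_n -> R) :
  connect (adj G) x y ->
  unit_potential G x y phi -> eff_res R G x y = (phi x - phi y)%:E.
Proof.
move=> cxy phiP; rewrite /eff_res cxy /=; case: xgetP => [psi _ psiP|]; last first.
  by move=> /(_ phi).
congr (_%:E).
have : psi x - phi x = psi y - phi y.
  apply: (@harmonic_connect R n G (fun v => psi v - phi v)) cxy => v.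
  transitivity (\sum_(w < n) (G v w)%:R * (psi v - psi w)
     - \sum_(w < n) (G v w)%:R * (phi v - phi w)).
    rewrite -sumrB; apply: eq_bigr => w _; rewrite -mulrBr; congr (_ * _).
    by rewrite !opprB addrACA [RHS]addrACA; congr (_ + _); rewrite addrC.
  by rewrite psiP phiP subrr.
move=> e; apply/eqP; rewrite -subr_eq0; apply/eqP.
transitivity ((psi x - phi x) - (psi y - phi y)); last by rewrite e subrr.
by rewrite !opprB addrACA [RHS]addrACA; congr (_ + _); rewrite addrC.
Qed.

Definition avg_res (R : realType) n (G : mgraph n) : \bar R :=
  ((('C(n, 2))%:R^-1)%:E *
   \sum_(x < n) \sum_(y < n | (x < y)%N) eff_res R G x y)%E.

Definition avg_res' (R : realType) n (G : mgraph n) : \bar R :=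
  (((n ^ 2)%:R^-1)%:E * \sum_(x < n) \sum_(y < n) eff_res R G x y)%E.

(* "Average degree alpha" is read as an upper bound on the number of edges,
   not as equality of [2 * nedges G / n] with [alpha]. *)
Definition has_avg_degree (R : realType) (alpha : R) n (G : mgraph n) : Prop :=
  (nedges G)%:R <= alpha * n%:R / 2.

(* Only finitely many graphs satisfy the edge constraint, and for
   [0 <= alpha] there is at least one, so this infimum is a minimum. *)
Definition min_res (R : realType) (alpha : R) (n : nat) : \bar R :=
  ereal_inf [set avg_res' R G | G in [set G : mgraph n | has_avg_degree alpha G]].

Definition lim_res (R : realType) (alpha : R) : \bar R :=
  limn (min_res alpha).

Definition minimises_avg_res (R : realType) (alpha : R) n (G : mgraph n) : Prop :=
  has_avg_degree alpha G /\
  forall H : mgraph n, has_avg_degree alpha H ->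
    (avg_res R G <= avg_res R H)%E.

(* Main.v *)
Require Import Defs.
From mathcomp Require Import all_boot all_order all_algebra.
From mathcomp Require Import all_classical all_reals all_analysis.
From mathcomp Require Import zify ring lra.
Import Order.TTheory GRing.Theory Num.Theory.
Import numFieldNormedType.Exports.
Set Implicit Arguments.
Unset Strict Implicit.
Unset Printing Implicit Defensive.
Local Open Scope ring_scope.

(* For every function [f], [R_xy >= 2 (f x - f y) - E(f)], where [E] is the
   Dirichlet energy.  Apply this to [f = f_x - f_y] for a family [f_x] of
   nonnegative functions of bounded mass and sum over all pairs: the mixed
   energies add up to [E(sum f_x) >= 0], so [A(G)] is at least twice the average
   of [2 f_x(x) - E(f_x)], up to [o(1)].

   Delete the [L] leaves of [G].  For a remaining vertex [x], [f_x] is a multiple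
   of a function supported at distance at most 2 from [x], vanishing at vertices
   of large degree or with many leaves, and subharmonic away from [x]; a leaf [z]
   at [u] gets [f_u] plus the indicator function of [z].  A discharging argument
   on the graph without leaves gives
     sum_x (2 f_x(x) - E(f_x)) >= 14/3 n - 10/3 e - L/3 - o(n),
   that is, [A(G) >= 11/6 + 2/3 eps + 8/3 (eps - gamma/4) - o(1)].  On the other
   hand [(1/8 - eps/2) n] triangles and otherwise only pendant edges, all sharing
   one vertex, have [A <= 11/6 + 2/3 eps + o(1)]. *)

(** * Dirichlet energy and effective resistance *)

Section Dirichlet.
Variables (R : realType) (n : nat) (G : mgraph n).
Implicit Types (f g : 'I_n -> R).

Definition lap f v : R := \sum_(w < n) (G v w)%:R * (f v - f w).

Definition dirichlet f g : R := \sum_(v < n) f v * lap g v.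

Definition energy f := dirichlet f f.

Lemma lapB f g v : lap (fun w => f w - g w) v = lap f v - lap g v.
Proof. by rewrite /lap -sumrB; apply: eq_bigr => w _; ring. Qed.

Lemma lapZ a f v : lap (fun w => a * f w) v = a * lap f v.
Proof. by rewrite /lap mulr_sumr; apply: eq_bigr => w _; ring. Qed.

Lemma lap_sum (I : finType) (F : I -> 'I_n -> R) v :
  lap (fun w => \sum_i F i w) v = \sum_i lap (F i) v.
Proof.
rewrite /lap exchange_big; apply: eq_bigr => w _ /=.
by rewrite -mulr_sumr sumrB.
Qed.

(** Summation by parts: averaging the defining sum with its copy under exchange of [v] and [w].
    Symmetry and [energy_ge0] are read off from this form. *)
Lemma dirichletE f g : dirichlet f g =
  2^-1 * \sum_(v < n) \sum_(w < n) (G v w)%:R * ((f v - f w) * (g v - g w)).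
Proof.
have E1 : dirichlet f g =
    \sum_(v < n) \sum_(w < n) (G v w)%:R * (f v * (g v - g w)).
  apply: eq_bigr => v _; rewrite mulr_sumr.
  by apply: eq_bigr => w _; ring.
have E2 : dirichlet f g =
    \sum_(v < n) \sum_(w < n) (G v w)%:R * (f w * (g w - g v)).
  rewrite E1 exchange_big; apply: eq_bigr => v _; apply: eq_bigr => w _.
  by rewrite mult_sym.
apply: (@mulfI _ 2); first by rewrite pnatr_eq0.
rewrite mulrA divff ?pnatr_eq0// mul1r mulr2n mulrDl mul1r {1}E1 E2 -big_split.
apply: eq_bigr => v _ /=; rewrite -big_split; apply: eq_bigr => w _ /=; ring.
Qed.

Lemma dirichletC f g : dirichlet f g = dirichlet g f.
Proof.
rewrite !dirichletE; congr (_ * _); apply: eq_bigr => v _; apply: eq_bigr => w _.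
by rewrite [in LHS](mulrC (f v - f w)).
Qed.

Lemma energy_ge0 f : 0 <= energy f.
Proof.
rewrite /energy dirichletE mulr_ge0 ?invr_ge0// ?ler0n//.
apply: sumr_ge0 => v _; apply: sumr_ge0 => w _.
by rewrite mulr_ge0 ?ler0n// -expr2 sqr_ge0.
Qed.

Lemma dirichletBl f g h :
  dirichlet (fun v => f v - g v) h = dirichlet f h - dirichlet g h.
Proof. by rewrite /dirichlet -sumrB; apply: eq_bigr => v _; ring. Qed.

Lemma dirichletDl f g h :
  dirichlet (fun v => f v + g v) h = dirichlet f h + dirichlet g h.
Proof. by rewrite /dirichlet -big_split; apply: eq_bigr => v _ /=; ring. Qed.

Lemma energyB f g :
  energy (fun v => f v - g v) = energy f + energy g - 2 * dirichlet f g.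
Proof.
rewrite /energy dirichletBl !(dirichletC _ (fun v => f v - g v)) !dirichletBl.
by rewrite (dirichletC g f); ring.
Qed.

Lemma energyD f g :
  energy (fun v => f v + g v) = energy f + energy g + 2 * dirichlet f g.
Proof.
rewrite /energy dirichletDl !(dirichletC _ (fun v => f v + g v)) !dirichletDl.
by rewrite (dirichletC g f); ring.
Qed.

Lemma energyZ a f : energy (fun v => a * f v) = a ^+ 2 * energy f.
Proof.
rewrite /energy /dirichlet mulr_sumr; apply: eq_bigr => v _.
by rewrite lapZ; ring.
Qed.

Lemma energy_sum (I : finType) (F : I -> 'I_n -> R) :
  energy (fun w => \sum_i F i w) = \sum_i \sum_j dirichlet (F i) (F j).
Proof.
rewrite /energy /dirichlet.
under eq_bigr do rewrite lap_sum mulr_suml.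
rewrite exchange_big; apply: eq_bigr => i _ /=.
under eq_bigr do rewrite mulr_sumr.
by rewrite exchange_big.
Qed.

(** Expand [energy (f - phi) >= 0]; Kirchhoff's law turns pairing with [phi] into the difference of
    values at [x] and [y]. *)
Lemma potential_lower_bound x y (phi f : 'I_n -> R) :
  unit_potential G x y phi -> 2 * (f x - f y) - energy f <= phi x - phi y.
Proof.
move=> phiP.
have D (g : 'I_n -> R) : dirichlet g phi = g x - g y.
  have sum_delta z : \sum_(v < n) g v * (v == z)%:R = g z.
    rewrite (bigD1 z)//= eqxx mulr1 big1 ?addr0// => i /negbTE ->.
    by rewrite mulr0.
  rewrite -[in RHS](sum_delta x) -[in RHS](sum_delta y) -sumrB.
  by apply: eq_bigr => v _; rewrite /lap phiP mulrBr.
have := energy_ge0 (fun v => f v - phi v).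
by rewrite energyB D {2}/energy D; lra.
Qed.

End Dirichlet.

(** * Lower bounds for effective resistances by test functions *)

Section Resistance.
Variables (R : realType) (n : nat) (G : mgraph n).

Definition res (x y : 'I_n) : R := fine (eff_res R G x y).

Lemma connect_adj_sym : connect_sym (adj G).
Proof.
by apply: sym_connect_sym => x y; rewrite /adj mult_sym.
Qed.

Lemma eff_res_connect x y : connect (adj G) x y -> eff_res R G x y = (res x y)%:E.
Proof. by move=> c; rewrite /res /eff_res c. Qed.

Lemma resE x y phi : connect (adj G) x y -> unit_potential G x y phi ->
  res x y = phi x - phi y.
Proof. by move=> c p; rewrite /res (eff_resE c p). Qed.

Lemma res_lower_bound x y (f : 'I_n -> R) : connect (adj G) x y ->
  2 * (f x - f y) - energy G f <= res x y.
Proof.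
move=> c; have [phi phiP] := unit_potential_exists R c.
by rewrite (resE c phiP); apply: potential_lower_bound.
Qed.

Lemma res_ge0 x y : connect (adj G) x y -> 0 <= res x y.
Proof.
move=> /(@res_lower_bound _ _ (fun=> 0)); apply: le_trans.
rewrite subrr mulr0 sub0r oppr_ge0 /energy /dirichlet big1// => v _.
by rewrite mul0r.
Qed.

Lemma res_xx x : res x x = 0.
Proof.
have [phi phiP] := unit_potential_exists R (connect0 (adj G) x).
by rewrite (resE (connect0 _ _) phiP) subrr.
Qed.

Lemma res_sym x y : connect (adj G) x y -> res x y = res y x.
Proof.
move=> c; have [phi phiP] := unit_potential_exists R c.
have c' : connect (adj G) y x by rewrite connect_adj_sym.
rewrite (resE c phiP) (@resE _ _ (fun v => - phi v) c'); first by ring.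
move=> v; have := phiP v => /(congr1 -%R).
rewrite opprB => <-; rewrite -sumrN; apply: eq_bigr => w _; ring.
Qed.

Lemma sum_res_lower_bound (F : 'I_n -> 'I_n -> R) :
  (forall x y, connect (adj G) x y) ->
  2 * n%:R * \sum_(x < n) (2 * F x x - energy G (F x))
    - 4 * \sum_(x < n) \sum_(y < n) F x y
  <= \sum_(x < n) \sum_(y < n) res x y.
Proof.
move=> c.
have h x y : 2 * F x x + 2 * F y y - energy G (F x) - energy G (F y)
     - 2 * F x y - 2 * F y x + 2 * dirichlet G (F x) (F y) <= res x y.
  have := @res_lower_bound x y (fun v => F x v - F y v) (c x y).
  by rewrite energyB; apply: le_trans; lra.
apply: (@le_trans _ _ (\sum_(x < n) \sum_(y < n)
  (2 * F x x + 2 * F y y - energy G (F x) - energy G (F y)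
     - 2 * F x y - 2 * F y x + 2 * dirichlet G (F x) (F y)))); last first.
  by apply: ler_sum => x _; apply: ler_sum => y _.
have E1 (a : 'I_n -> R) : \sum_(x < n) \sum_(y < n) a x = n%:R * \sum_(x < n) a x.
  by rewrite mulr_sumr; apply: eq_bigr => x _; rewrite sumr_const card_ord mulr_natl.
have E2 (a : 'I_n -> R) : \sum_(x < n) \sum_(y < n) a y = n%:R * \sum_(x < n) a x.
  by rewrite exchange_big E1.
have -> : \sum_(x < n) \sum_(y < n)
  (2 * F x x + 2 * F y y - energy G (F x) - energy G (F y)
     - 2 * F x y - 2 * F y x + 2 * dirichlet G (F x) (F y)) =
  \sum_(x < n) \sum_(y < n) (2 * F x x - energy G (F x)) +
  \sum_(x < n) \sum_(y < n) (2 * F y y - energy G (F y))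
  - 2 * \sum_(x < n) \sum_(y < n) F x y - 2 * \sum_(x < n) \sum_(y < n) F y x
  + 2 * \sum_(x < n) \sum_(y < n) dirichlet G (F x) (F y).
  rewrite !mulr_sumr -!sumrN -!big_split /=; apply: eq_bigr => x _.
  rewrite !mulr_sumr -!sumrN -!big_split /=; apply: eq_bigr => y _; ring.
rewrite E1 (E2 (fun y => 2 * F y y - energy G (F y))).
rewrite [\sum_(x < n) \sum_(y < n) F y x]exchange_big /=.
have := energy_ge0 G (fun w => \sum_x F x w); rewrite energy_sum.
by lra.
Qed.

End Resistance.

(** * Subharmonic test functions *)

(** Takes one element out of a multiset; repeated use lists the neighbours of a vertex of degree 1
    or 2 with multiplicity. *)
Lemma sum_pull (R : realType) (I : finType) (m : I -> nat) (x : I) : (0 < m x)%N ->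
  exists m' : I -> nat, [/\ (\sum_v m v = (\sum_v m' v).+1)%N,
    forall v, (m' v <= m v)%N &
    forall F : I -> R, \sum_v (m v)%:R * F v = F x + \sum_v (m' v)%:R * F v].
Proof.
move=> mx; exists (fun v => if v == x then (m x).-1 else m v); split.
- rewrite (bigD1 x)//= [in RHS](bigD1 x)//= eqxx -addSn prednK//.
  by congr (_ + _)%N; apply: eq_bigr => v /negbTE ->.
- by move=> v; case: eqP => // ->; apply: leq_pred.
- move=> F; rewrite (bigD1 x)//= [in RHS](bigD1 x)//= eqxx addrA.
  congr (_ + _); last by apply: eq_bigr => v /negbTE ->.
  by rewrite -{1}(prednK mx) -add1n natrD; ring.
Qed.

Lemma sum_degree1 (R : realType) n (H : mgraph n) (u x : 'I_n) (F : 'I_n -> R) :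
  degree H u = 1%N -> (0 < H u x)%N -> \sum_(v < n) (H u v)%:R * F v = F x.
Proof.
move=> du hx; have [m' [E _ EF]] := @sum_pull R _ (H u) x hx.
move: E; rewrite -/(degree H u) du => -[] /esym /eqP.
rewrite sum_nat_eq0 => /forallP m0; rewrite EF big1 ?addr0// => v _.
by rewrite (eqP (m0 v)) mul0r.
Qed.

Lemma sum_degree2 (R : realType) n (H : mgraph n) (u x : 'I_n) :
  degree H u = 2%N -> (0 < H u x)%N ->
  exists2 q : 'I_n, (0 < H u q)%N &
    forall F : 'I_n -> R, \sum_(v < n) (H u v)%:R * F v = F x + F q.
Proof.
move=> du hx; have [m' [E le EF]] := @sum_pull R _ (H u) x hx.
move: E; rewrite -/(degree H u) du => -[] E.
have [w mw] : exists w, (0 < m' w)%N.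
  case: (pickP (fun w => (0 < m' w)%N)) => [w mw|m0]; first by exists w.
  by move: E; rewrite big1// => v _; apply/eqP; rewrite eqn0Ngt m0.
have [m'' [E' _ EF']] := @sum_pull R _ m' w mw.
exists w; first exact: leq_trans mw (le w).
move=> F; rewrite EF EF'; congr (_ + _); rewrite big1 ?addr0// => v _.
move: E'; rewrite -E => -[] /esym /eqP; rewrite sum_nat_eq0 => /forallP m0.
by rewrite (eqP (m0 v)) mul0r.
Qed.

Lemma natr_degree (R : realType) n (H : mgraph n) x :
  (degree H x)%:R = \sum_(v < n) (H x v)%:R :> R.
Proof. by rewrite natr_sum. Qed.

Section Local.
Variables (R : realType) (n : nat) (H : mgraph n) (hub : pred 'I_n).

(* Test functions vanish on class 7: degree at least 7, or hub. *)
Definition vclass (x : 'I_n) : nat := if hub x then 7%N else minn (degree H x) 7.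

(* Value at a vertex of class [c] at distance two from the source, through a
   vertex of degree 2; [degree * psi] is at most the value at the middle vertex. *)
Definition psi (c : nat) : R :=
  if (c <= 2)%N then 1 / 3 else if c == 3 then 1 / 5 else 0.

(** For [u] of degree 2 next to [x] this is [F] at the other neighbour, and for degree 1 it is 0;
    the difference of sums avoids choosing that neighbour. *)
Definition other (F : 'I_n -> R) (u x : 'I_n) : R :=
  \sum_(v < n) (H u v)%:R * F v - F x.

(* Value at a neighbour [v] of the source [x].  For [degree H v = 2] it is the
   mean of [1] and of [psi] at the other neighbour of [v]; the last summand makes
   it [2 / 3] for [degree H v = 1]. *)
Definition nbr_pot (x v : 'I_n) : R :=
  if (vclass v <= 2)%N then
    1 / 2 + other (fun w => psi (vclass w)) v x / 2 + (2 - (degree H v)%:R) / 6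
  else if (vclass v <= 6)%N then (vclass v)%:R^-1 else 0.

Definition second (x v : 'I_n) : bool :=
  [exists u, [&& (0 < H x u)%N, (vclass u <= 2)%N & (0 < H u v)%N]].

Definition pot (x v : 'I_n) : R :=
  if v == x then 1
  else Num.max (if (0 < H x v)%N then nbr_pot x v else 0)
               (if second x v then psi (vclass v) else 0).

(** The current leaving [x] under [pot x] ([lap_pot]); it bounds the energy of [pot x] from above
    ([energy_extend_pot]). *)
Definition conductance (x : 'I_n) : R :=
  \sum_(u < n) (H x u)%:R * (1 - nbr_pot x u).

Lemma vclass_degree x : (vclass x <= 6)%N -> degree H x = vclass x.
Proof. by rewrite /vclass; case: (hub x) => //; lia. Qed.

Lemma vclass_le7 x : (vclass x <= 7)%N.
Proof. by rewrite /vclass; case: (hub x) => //; lia. Qed.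

Lemma degree_gt0 x y : (0 < H x y)%N -> (0 < degree H x)%N.
Proof. by move=> h; apply: leq_trans h _; rewrite /degree (bigD1 y)//= leq_addr. Qed.

Lemma psi_ge0 c : 0 <= psi c.
Proof. by rewrite /psi; case: ifP => _; [|case: ifP => _]; lra. Qed.

Lemma psi_le c : psi c <= 1 / 3.
Proof. by rewrite /psi; case: ifP => _; [|case: ifP => _]; lra. Qed.

(** In the second case [q = x] is possible: a double edge. *)
Variant small_spec (u x : 'I_n) : Prop :=
  | SmallLeaf of degree H u = 1%N & vclass u = 1%N &
      (forall F : 'I_n -> R, \sum_(v < n) (H u v)%:R * F v = F x)
  | SmallPath (q : 'I_n) of degree H u = 2%N & vclass u = 2%N & (0 < H u q)%N &
      (forall F : 'I_n -> R, \sum_(v < n) (H u v)%:R * F v = F x + F q).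

Lemma smallP u x : (vclass u <= 2)%N -> (0 < H u x)%N -> small_spec u x.
Proof.
move=> cu hx; have du : degree H u = vclass u by apply: vclass_degree; lia.
have d0 := degree_gt0 hx.
have [d1|d2] : degree H u = 1%N \/ degree H u = 2%N by lia.
  by apply: SmallLeaf => //; [lia|move=> F; apply: sum_degree1].
have [q ho E] := sum_degree2 R d2 hx.
by apply: (SmallPath (q := q)) => //; lia.
Qed.

Lemma nbr_pot_leaf x u : (0 < H x u)%N -> vclass u = 1%N -> nbr_pot x u = 2 / 3.
Proof.
rewrite mult_sym => h cu; have [du _ E|q _] : small_spec u x by apply: smallP; rewrite ?cu.
  by rewrite /nbr_pot cu /= /other E du subrr; lra.
by rewrite cu.
Qed.

Lemma nbr_pot_path x u q : (0 < H x u)%N -> vclass u = 2%N ->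
  (forall F : 'I_n -> R, \sum_(v < n) (H u v)%:R * F v = F x + F q) ->
  nbr_pot x u = (1 + psi (vclass q)) / 2.
Proof.
move=> h cu E; rewrite /nbr_pot /other E vclass_degree cu //=; lra.
Qed.

Lemma nbr_pot_small x u : (0 < H x u)%N -> (vclass u <= 2)%N ->
  1 / 2 <= nbr_pot x u <= 2 / 3.
Proof.
move=> h cu; have [] : small_spec u x by apply: smallP; rewrite 1?mult_sym.
  by move=> _ c1 _; rewrite nbr_pot_leaf//; lra.
move=> q _ c2 _ E; rewrite (nbr_pot_path h c2 E).
have := psi_ge0 (vclass q); have := psi_le (vclass q); lra.
Qed.

Lemma nbr_pot_large x u : (2 < vclass u)%N -> 0 <= nbr_pot x u <= 1 / 3.
Proof.
move=> cu; rewrite /nbr_pot leqNgt cu /=; case: ifP => _; last by lra.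
rewrite invr_ge0 ler0n /= div1r lef_pV2 ?posrE ?ltr0n ?ler_nat//; lia.
Qed.

Lemma nbr_pot_bounds x u : (0 < H x u)%N -> 0 <= nbr_pot x u <= 2 / 3.
Proof.
move=> h; case: (leqP (vclass u) 2) => cu.
  by have := nbr_pot_small h cu; lra.
by have := nbr_pot_large x cu; lra.
Qed.

Lemma pot_xx x : pot x x = 1. Proof. by rewrite /pot eqxx. Qed.

Lemma pot_ge0 x v : 0 <= pot x v.
Proof.
rewrite /pot; case: eqP => _; first exact: ler01.
by rewrite le_max orbC; case: ifP => _; rewrite ?psi_ge0 ?lexx.
Qed.

(** At a neighbour the first piece of the maximum wins: at least 1/2 against 1/3 in class at most 2,
    1/3 against 1/5 in class 3, and [psi] is 0 in higher classes. *)
Lemma pot_nbr x v : (0 < H x v)%N -> pot x v = nbr_pot x v.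
Proof.
move=> h; rewrite /pot; case: eqVneq => [e|_]; first by move: h; rewrite e mult_irr.
rewrite h; apply/max_idPl.
case: ifP => _; last by case/andP: (nbr_pot_bounds h).
case: (leqP (vclass v) 2) => cv.
  by have := nbr_pot_small h cv; have := psi_le (vclass v); lra.
case: (eqVneq (vclass v) 3) => c3.
  by rewrite /psi /nbr_pot c3 /=; lra.
by rewrite /psi leqNgt cv (negbTE c3); case/andP: (nbr_pot_large x cv).
Qed.

Lemma pot_second x u v : (0 < H x u)%N -> (vclass u <= 2)%N -> (0 < H u v)%N ->
  psi (vclass v) <= pot x v.
Proof.
move=> hu cu hv; rewrite /pot; case: eqP => _.
  by have := psi_le (vclass v); lra.
have -> : second x v by apply/existsP; exists u; rewrite hu cu hv.
by rewrite le_max lexx orbT.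
Qed.

Lemma lapE (f : 'I_n -> R) v :
  lap H f v = (degree H v)%:R * f v - \sum_(w < n) (H v w)%:R * f w.
Proof.
by rewrite natr_degree mulr_suml -sumrB; apply: eq_bigr => w _; rewrite mulrBr.
Qed.

Lemma term_le_sum (f : 'I_n -> R) v w : (forall z, 0 <= f z) -> (0 < H v w)%N ->
  f w <= \sum_(z < n) (H v z)%:R * f z.
Proof.
move=> f0 h; rewrite (bigD1 w)//= -[leLHS]addr0 lerD//.
  by rewrite -[leLHS]mul1r ler_wpM2r// ler1n.
by apply: sumr_ge0 => z _; rewrite mulr_ge0.
Qed.

Lemma sum_delta u v : \sum_(w < n) (H u w)%:R * (w == v)%:R = (H u v)%:R :> R.
Proof.
rewrite (bigD1 v)//= eqxx mulr1 big1 ?addr0// => w /negbTE ->.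
by rewrite mulr0.
Qed.

(* Each of the harmonic pieces of [pot x] is subharmonic away from [x], and so
   is their maximum. *)
Lemma pot_subharmonic x v : v != x -> 0 < pot x v -> lap H (pot x) v <= 0.
Proof.
move=> vx p0; rewrite lapE subr_le0.
have P0 := pot_ge0 x.
case: (posnP (H x v)) => hv; last first.
  rewrite (pot_nbr hv).
  have hv' : (0 < H v x)%N by rewrite mult_sym.
  case: (leqP (vclass v) 2) => cv.
    case: (smallP cv hv') => [dv cv' E|q dv cv' ho E].
      by rewrite E dv pot_xx nbr_pot_leaf//; lra.
    rewrite E dv pot_xx (nbr_pot_path hv cv' E).
    by have := pot_second hv cv ho; lra.
  case: (leqP (vclass v) 6) => c6.
    rewrite vclass_degree// /nbr_pot leqNgt cv c6 /= mulfV; last first.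
      by rewrite pnatr_eq0; lia.
    by have := term_le_sum P0 hv'; rewrite pot_xx.
  rewrite /nbr_pot leqNgt cv /= leqNgt c6 /= mulr0.
  by apply: sumr_ge0 => z _; rewrite mulr_ge0.
have pv : pot x v = if second x v then psi (vclass v) else 0.
  rewrite /pot (negbTE vx) hv ltnn; apply/max_idPr.
  by case: ifP => _; rewrite ?psi_ge0.
move: p0; rewrite pv; case: ifP => [/existsP[u /and3P[hu cu huv]] p0|_]; last first.
  by rewrite ltxx.
have hvu : (0 < H v u)%N by rewrite mult_sym.
apply: le_trans (term_le_sum P0 hvu); rewrite (pot_nbr hu).
have hux : (0 < H u x)%N by rewrite mult_sym.
have huvR : (H u v)%:R <> 0 :> R by apply/eqP; rewrite pnatr_eq0 -lt0n.
(* Tested on the indicator function of [v], the neighbour identity excludes that [u] has degree 1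
   and forces [q = v]. *)
case: (smallP cu hux) => [_ _ /(_ (fun w => (w == v)%:R))|q du cu' ho E].
  by rewrite sum_delta (eq_sym x) (negbTE vx).
have ov : q = v.
  have := E (fun w => (w == v)%:R); rewrite sum_delta (eq_sym x) (negbTE vx).
  by rewrite add0r; case: eqP.
(* The values 1/3 and 1/5 of [psi] solve [d * p = (1 + p) / 2] for [d = 2] and [d = 3], so the
   inequality is tight there. *)
rewrite (nbr_pot_path hu cu' E) ov.
move: p0; rewrite /psi; case: ifP => c2 p0.
  rewrite vclass_degree; last by lia.
  have : (vclass v)%:R <= (2 : R) by rewrite ler_nat.
  by lra.
move: p0; case: eqP => [c3 _|_]; last by rewrite ltxx.
by rewrite vclass_degree c3 //; lra.
Qed.

Lemma lap_pot x : lap H (pot x) x = conductance x.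
Proof.
apply: eq_bigr => u _; rewrite pot_xx; case: (posnP (H x u)) => [->|h].
  by rewrite !mul0r.
by rewrite pot_nbr.
Qed.

Lemma conductance_ge x : (degree H x)%:R / 3 <= conductance x.
Proof.
rewrite natr_degree mulr_suml; apply: ler_sum => u _.
case: (posnP (H x u)) => [->|h]; first by rewrite !mul0r.
by rewrite ler_wpM2l ?ler0n//; have := nbr_pot_bounds h; lra.
Qed.

Lemma pot_support x v : v != x -> 0 < pot x v -> (vclass v <= 6)%N.
Proof.
move=> vx; rewrite /pot (negbTE vx) lt_max => p0.
rewrite leqNgt; apply/negP => cv; move: p0.
have c7 : vclass v = 7%N by have := vclass_le7 v; lia.
rewrite /psi /nbr_pot c7 /=; case: ifP => _; case: ifP => _; rewrite ltxx //.
Qed.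

(** [19 = 1 + 6 + 6 * 2]: the source, at most 6 edges to neighbours, and at most 2 edges from each
    neighbour of class at most 2. All values are at most 1. *)
Lemma sum_pot x : (degree H x <= 6)%N -> \sum_(v < n) pot x v <= 19.
Proof.
move=> dx.
apply: (@le_trans _ _ (\sum_(v < n) ((v == x)%:R + (H x v)%:R +
    \sum_(u < n) (H x u)%:R * ((vclass u <= 2)%N%:R * (H u v)%:R)))).
  apply: ler_sum => v _.
  have s0 : 0 <= \sum_(u < n) (H x u)%:R * ((vclass u <= 2)%N%:R * (H u v)%:R) :> R.
    by apply: sumr_ge0 => u _; rewrite !mulr_ge0.
  have H0 := ler0n R (H x v).
  rewrite /pot; case: eqP => _; rewrite ?mulr1n ?mulr0n ?add0r; first by lra.
  rewrite ge_max; apply/andP; split.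
    case: ifP => h; last by lra.
    have : 1 <= (H x v)%:R :> R by rewrite ler1n.
    by have := nbr_pot_bounds h; lra.
  case: ifP => [/existsP[u /and3P[hu cu huv]]|_]; last by lra.
  have : (1 : R) <= \sum_(u < n) (H x u)%:R * ((vclass u <= 2)%N%:R * (H u v)%:R).
    rewrite (bigD1 u)//= cu mul1r -[leLHS]addr0 lerD//.
      by rewrite -natrM ler1n muln_gt0 hu.
    by apply: sumr_ge0 => z _; rewrite !mulr_ge0.
  by have := psi_le (vclass v); lra.
have d6 : (degree H x)%:R <= 6 :> R by rewrite ler_nat.
rewrite !big_split /= -natr_degree.
have -> : \sum_(v < n) (v == x)%:R = 1 :> R.
  by rewrite (bigD1 x)//= eqxx big1 ?addr0// => v /negbTE ->.
rewrite exchange_big /=.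
have : \sum_(u < n) \sum_(v < n) (H x u)%:R * ((vclass u <= 2)%N%:R * (H u v)%:R)
    <= \sum_(u < n) (H x u)%:R * 2 :> R.
  apply: ler_sum => u _; rewrite -!mulr_sumr ler_wpM2l ?ler0n// -natr_degree.
  case: (leqP (vclass u) 2) => cu; last by rewrite mul0r.
  by rewrite mul1r ler_nat vclass_degree//; lia.
by rewrite -mulr_suml -natr_degree; lra.
Qed.

End Local.

(** * Discharging *)

Section Discharging.
Variables (R : realType) (n : nat) (H : mgraph n) (hub : pred 'I_n).
Local Notation cl := (vclass H hub).
Local Notation psiR := (psi R).
Local Notation npot := (nbr_pot R H hub).
Local Notation cond := (conductance R H hub).
Local Notation oth := (@other R n H).

(** Charge that a vertex of degree 2 passes to a neighbour of degree at most 2 when its other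
    neighbour has class [c]. *)
Definition gam (c : nat) : R :=
  if (c <= 2)%N then 0 else if c == 3 then 1 / 16 else 1 / 5.

(* What [x] gives to [u] along each edge; only vertices of degree at most 2
   receive anything.  For class 3, [5 / 9 = (2 a - (14 / 3 - 5 / 3 * 3)) / 3] with
   [a = 2 / 3], see [balance_tangent]; the other constants are chosen so that
   [path_balance] holds. *)
Definition transfer (x u : 'I_n) : R :=
  if (2 < cl u)%N then 0
  else if (cl x <= 2)%N then oth (fun w => gam (cl w)) x u
  else if cl x == 3 then 5 / 9 - 4 / 9 * (1 - npot x u)
  else if cl x == 4 then 5 / 8
  else if (cl x <= 6)%N then 4 / 5 else 1.

(** [(cond x)^-1] is both the scale [a] maximising [2 a - a^2 cond x] and the maximum. The value 0
    switches the test function off in class 7. *)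
Definition local_res (x : 'I_n) : R :=
  if (cl x <= 6)%N then (cond x)^-1 else 0.

Lemma gam_ge0 c : 0 <= gam c.
Proof. by rewrite /gam; case: ifP => _; [|case: ifP => _]; lra. Qed.

Lemma local_res_ge0 x : 0 <= local_res x.
Proof.
rewrite /local_res; case: ifP => // _; rewrite invr_ge0.
by apply: le_trans (conductance_ge R H hub x); rewrite divr_ge0.
Qed.

Lemma le_invr (y r : R) : 0 < y -> r * y <= 1 -> r <= y^-1.
Proof. by move=> y0; rewrite -ler_pdivlMr// div1r. Qed.

(* [side c c' y t]: a vertex of degree 2 with neighbours of classes [c] and
   [c'] has branch cond [y] on the side of [c], and receives [t] from
   there. *)
Variant side (c c' : nat) : R -> R -> Prop :=
  | Side2 of (c <= 2)%N : side c c' (1 / 3) 0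
  | Side23 of (c <= 2)%N : side c c' (2 / 5) (1 / 16)
  | Side24 of (c <= 2)%N : side c c' (1 / 2) (1 / 5)
  | Side3 of c = 3%N : side c c' (2 / 3) (5 / 9 - 4 / 9 * (1 / 2 - psiR c' / 2))
  | Side4 of c = 4%N : side c c' (3 / 4) (5 / 8)
  | Side5 of c = 5%N : side c c' (4 / 5) (4 / 5)
  | Side6 of c = 6%N : side c c' (5 / 6) (4 / 5)
  | Side7 of c = 7%N : side c c' 1 1.

(** If [u] has class at most 2, its further neighbour decides: absent or of class at most 2 for
    [Side2], of class 3 for [Side23], of class at least 4 for [Side24]. *)
Lemma sideP x u v : (0 < H x u)%N -> cl x = 2%N ->
  (forall F : 'I_n -> R, \sum_(w < n) (H x w)%:R * F w = F u + F v) ->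
  side (cl u) (cl v) (1 - npot x u) (transfer u x).
Proof.
move=> h cx E; rewrite /transfer cx /=.
have h' : (0 < H u x)%N by rewrite mult_sym.
case: (leqP (cl u) 2) => cu.
  case: (smallP R cu h') => [_ c1 Eu|q _ c2 _ Eu].
    rewrite nbr_pot_leaf// /other Eu subrr.
    have -> : 1 - 2 / 3 = 1 / 3 :> R by lra.
    by constructor.
  rewrite (nbr_pot_path h c2 Eu) /other Eu [X in side _ _ _ X]addrC addKr.
  rewrite /psi /gam; case: (leqP (cl q) 2) => cq.
    have -> : 1 - (1 + 1 / 3) / 2 = 1 / 3 :> R by lra.
    by constructor.
  case: eqP => _.
    have -> : 1 - (1 + 1 / 5) / 2 = 2 / 5 :> R by lra.
    by constructor.
  have -> : 1 - (1 + 0) / 2 = 1 / 2 :> R by lra.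
  by constructor.
have Ex : npot u x = (1 + psiR (cl v)) / 2 by apply: nbr_pot_path.
have := vclass_le7 H hub u.
rewrite Ex /nbr_pot ![(cl u <= 2)%N]leqNgt cu /=.
case: (eqVneq (cl u) 3) => [c3 _|n3].
  rewrite c3 /=.
  have -> : 1 - (1 + psiR (cl v)) / 2 = 1 / 2 - psiR (cl v) / 2 by lra.
  have -> : 1 - 3^-1 = 2 / 3 :> R by lra.
  by constructor.
case: (eqVneq (cl u) 4) => [-> _ /=|n4].
  have -> : 1 - 4^-1 = 3 / 4 :> R by lra.
  by constructor.
case: (eqVneq (cl u) 5) => [-> _ /=|n5].
  have -> : 1 - 5^-1 = 4 / 5 :> R by lra.
  by constructor.
case: (eqVneq (cl u) 6) => [-> _ /=|n6].
  have -> : 1 - 6^-1 = 5 / 6 :> R by lra.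
  by constructor.
move=> c7; have -> : cl u = 7%N by lia.
by rewrite /= subr0; constructor.
Qed.

(** [4 / 3 = 14 / 3 - 5 / 3 * 2] is the demand of a vertex of degree 2, and the subtracted terms are
    what it passes on. Once the inverse is cleared, each pair of sides is a linear check. *)
Lemma path_balance c c' y y' t t' : side c c' y t -> side c' c y' t' ->
  4 / 3 <= (y + y')^-1 + t + t' - (if (c <= 2)%N then gam c' else 0)
           - (if (c' <= 2)%N then gam c else 0).
Proof.
move=> S S'.
set g := if (c <= 2)%N then _ else _; set g' := if (c' <= 2)%N then _ else _.
suff : 0 < y + y' /\ (4 / 3 - t - t' + g + g') * (y + y') <= 1.
  by move=> [y0 /(le_invr y0)]; lra.
rewrite {}/g {}/g' /gam.
case: S => hc; case: S' => hc'; rewrite /psi ?hc ?hc' /= ?hc ?hc' /=; split; lra.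
Qed.

Lemma conductance_gt0 x : (0 < degree H x)%N -> 0 < cond x.
Proof.
move=> d0; apply: lt_le_trans (conductance_ge R H hub x).
by rewrite divr_gt0 ?ltr0n.
Qed.

Lemma transfer_to_large x u : (2 < cl u)%N -> transfer x u = 0.
Proof. by rewrite /transfer => ->. Qed.

Lemma transfer_ge0 x u : (0 < H x u)%N -> 0 <= transfer x u.
Proof.
move=> h; have h' : (0 < H u x)%N by rewrite mult_sym.
rewrite /transfer /other; case: ifP => // _; case: (leqP (cl x) 2) => cx.
  by case: (smallP R cx h) => [_ _ ->|q _ _ _ ->];
    rewrite ?subrr// addrC addKr gam_ge0.
by have := nbr_pot_bounds R hub h; do 3!(case: ifP => _; first lra); lra.
Qed.

(** Each edge carries away at most 1, and [14/3 - 5/3 d <= -d] holds exactly from [d = 7] on, whence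
    the cutoff in [vclass]. A hub of smaller degree is paid for by the extra 14/3. *)
Lemma balance_big x : (6 < cl x)%N ->
  (14 / 3 - 5 / 3 * (degree H x)%:R) - 14 / 3 * (hub x)%:R <=
  \sum_(u < n) (H x u)%:R * (transfer u x - transfer x u).
Proof.
move=> cx; apply: (@le_trans _ _ (- (degree H x)%:R)).
  case: (boolP (hub x)) => hx /=; first by have := ler0n R (degree H x); lra.
  have : (7 : R) <= (degree H x)%:R.
    by rewrite ler_nat; move: cx; rewrite /vclass (negbTE hx); lia.
  by lra.
rewrite natr_degree -sumrN; apply: ler_sum => u _.
rewrite transfer_to_large ?sub0r ?mulrN ?lerN2; last by lia.
rewrite -[leRHS]mulr1 ler_wpM2l// /transfer; case: ifP => _ //.
by do 3!(rewrite ifN; last by lia); rewrite ifN//; lia.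
Qed.

(* [t <= s - a^2 y] on every edge, together with [1 / Y >= 2 a - a^2 Y]. *)
Lemma balance_tangent x (a s : R) : (2 < cl x <= 6)%N ->
  (forall u, (0 < H x u)%N -> a ^+ 2 * (1 - npot x u) + transfer x u <= s) ->
  14 / 3 - 5 / 3 * (degree H x)%:R <= 2 * a - (degree H x)%:R * s ->
  14 / 3 - 5 / 3 * (degree H x)%:R <= local_res x +
  \sum_(u < n) (H x u)%:R * (transfer u x - transfer x u).
Proof.
move=> /andP[cx cx'] hs; have dx := vclass_degree cx'.
have Y0 : 0 < cond x by apply: conductance_gt0; lia.
rewrite /local_res cx' => /le_trans; apply.
have h1 : 2 * a - a ^+ 2 * cond x <= (cond x)^-1.
  by apply: le_invr => //; have := sqr_ge0 (a * cond x - 1); lra.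
have : a ^+ 2 * cond x - (degree H x)%:R * s <=
    \sum_(u < n) (H x u)%:R * (transfer u x - transfer x u).
  rewrite natr_degree /conductance mulr_sumr mulr_suml -sumrB.
  apply: ler_sum => u _; case: (posnP (H x u)) => [->|hu].
    by rewrite !mul0r mulr0 subr0.
  rewrite transfer_to_large// mulrCA -mulrBr ler_wpM2l//.
  by have := hs u hu; lra.
by lra.
Qed.

(** The factor 2 is available because a vertex of core degree 1 carries a leaf of the original
    graph, whose test function repeats that of the vertex. *)
Lemma local_balance x : (0 < degree H x)%N || hub x ->
  (14 / 3 - 5 / 3 * (degree H x)%:R) - 14 / 3 * (hub x)%:R <=
  (if degree H x == 1%N then 2 else 1) * local_res x
  + \sum_(u < n) (H x u)%:R * (transfer u x - transfer x u).
Proof.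
move=> dx.
case: (leqP (cl x) 6) => cx; last first.
  by rewrite /local_res leqNgt cx mulr0 add0r; apply: balance_big.
have hx : hub x = false.
  by apply/negP => hx; move: cx; rewrite /vclass hx.
have d0 : (0 < degree H x)%N by move: dx; rewrite hx orbF.
have dc := vclass_degree cx.
rewrite hx mulr0 subr0.
case: (leqP (cl x) 2) => c2; last first.
  rewrite dc ifN ?mul1r -?dc; last by lia.
  case: (eqVneq (cl x) 3) => [c3|n3].
    apply: (@balance_tangent x (2 / 3) (5 / 9)); rewrite ?cx ?c2// ?dc ?c3; last by lra.
    move=> u hu; rewrite /transfer c3 /=; case: ifP => _; last by lra.
    by have := nbr_pot_bounds R hub hu; lra.
  (* With [a = 1/2] an edge to class at most 2 costs at most [1/4 * 1/2] plus the transfer: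
     [1/8 + 5/8 = 3/4] in class 4, [1/8 + 4/5 = 37/40] in classes 5 and 6. Degree 4 is tight. *)
  apply: (@balance_tangent x (1 / 2) (if cl x == 4 then 3 / 4 else 37 / 40)).
  - by rewrite c2.
  - move=> u hu; rewrite /transfer (leqNgt (cl x)) c2 (negbTE n3) cx /=.
    case: (leqP (cl u) 2) => cu.
      by have := nbr_pot_small R hu cu; case: ifP => _; lra.
    by have := nbr_pot_bounds R hub hu; case: ifP => _; lra.
  - rewrite dc; have : (cl x = 4 \/ cl x = 5 \/ cl x = 6)%N by lia.
    by move=> [->|[->|->]] /=; lra.
have [u hu] : exists u, (0 < H x u)%N.
  case: (pickP (fun u => (0 < H x u)%N)) => [u hu|h0]; first by exists u.
  move: d0; rewrite /degree big1// => u _.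
  by apply/eqP; rewrite eqn0Ngt h0.
have hu' : (0 < H u x)%N by rewrite mult_sym.
have Y0 := conductance_gt0 d0.
rewrite /local_res cx; move: Y0; rewrite /conductance.
case: (smallP R c2 hu) => [d1 c1 E|v d2 c2' hv E].
  rewrite !E d1 /= => Y0.
  have -> : transfer x u = 0.
    rewrite /transfer c1 /= /other E subrr; by case: ifP.
  have T0 := transfer_ge0 hu'.
  (* The demand is [14/3 - 5/3 = 3]; [r] is a rational lower bound for the inverse conductance,
     which counts twice. *)
  suff [r h1 /(le_invr Y0) h2] :
      exists2 r, 3 - transfer u x <= 2 * r & r * (1 - npot x u) <= 1 by lra.
  case: (leqP (cl u) 2) => cu.
    by exists 2; have := nbr_pot_small R hu cu; lra.
  have := vclass_le7 H hub u.
  move: T0; rewrite /nbr_pot /transfer c1 ![(cl u <= 2)%N]leqNgt cu /=.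
  case: (eqVneq (cl u) 3) => [c3 T0 _|n3].
    by rewrite c3 /=; exists (3 / 2); lra.
  case: (eqVneq (cl u) 4) => [-> _ _ /=|n4]; first by exists (4 / 3); lra.
  case: (leqP (cl u) 6) => c6 _ c7.
    exists (6 / 5); first by lra.
    have : (cl u = 5 \/ cl u = 6)%N by lia.
    by move=> [->|->]; lra.
  by exists 1; lra.
rewrite !E d2 /= => Y0; rewrite mul1r.
have hv' : (0 < H v x)%N by rewrite mult_sym.
have E' (F : 'I_n -> R) : \sum_(w < n) (H x w)%:R * F w = F v + F u.
  by rewrite E addrC.
have := path_balance (sideP hu c2' E) (sideP hv c2' E').
have -> : transfer x u = if (cl u <= 2)%N then gam (cl v) else 0.
  by rewrite /transfer c2' /= /other E addrC addKr ltnNge; case: (cl u <= 2)%N.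
have -> : transfer x v = if (cl v <= 2)%N then gam (cl u) else 0.
  by rewrite /transfer c2' /= /other E' addrC addKr ltnNge; case: (cl v <= 2)%N.
lra.
Qed.

End Discharging.

(** * Leaves *)

Lemma sum_degree n (G : mgraph n) : (\sum_(x < n) degree G x = (nedges G).*2)%N.
Proof.
have up : nedges G = (\sum_(x < n) \sum_(y < n) if (x < y)%N then G x y else 0)%N.
  by apply: eq_bigr => x _; rewrite big_mkcond.
have down : nedges G = (\sum_(x < n) \sum_(y < n) if (y < x)%N then G x y else 0)%N.
  rewrite up exchange_big; apply: eq_bigr => x _; apply: eq_bigr => y _.
  by rewrite mult_sym.
rewrite -addnn {1}up down -big_split; apply: eq_bigr => x _ /=.
rewrite /degree -big_split; apply: eq_bigr => y _ /=.
case: ltngtP => [_|_|/ord_inj ->]; rewrite ?addn0//.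
by rewrite mult_irr.
Qed.

Lemma sum_leaves n (G : mgraph n) :
  (\sum_(x < n | degree G x == 1%N) 1 = nleaves G)%N.
Proof. by rewrite sum1dep_card. Qed.

Section Core.
Variables (R : realType) (n : nat) (G : mgraph n) (K : nat).
Hypothesis conn : forall x y, connect (adj G) x y.
Hypothesis n_gt2 : (2 < n)%N.
Hypothesis K_lt_n : (K < n)%N.

Definition leaf (x : 'I_n) : bool := degree G x == 1%N.

(** Leaves remain as isolated vertices, so the core has the same vertex type as [G]. *)
Definition core_mult (x y : 'I_n) : nat := if leaf x || leaf y then 0%N else G x y.

Lemma core_mult_sym x y : core_mult x y = core_mult y x.
Proof. by rewrite /core_mult orbC mult_sym. Qed.

Lemma core_mult_irr x : core_mult x x = 0%N.
Proof. by rewrite /core_mult mult_irr; case: ifP. Qed.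

Definition core : mgraph n := MGraph core_mult_sym core_mult_irr.

Definition pendants (x : 'I_n) : nat := (\sum_(z < n | leaf z) G x z)%N.

(** Many leaves at a vertex would give an extended test function too much mass, so test functions of
    other vertices vanish there. At most [n / K] such vertices exist ([sum_hub]). *)
Definition hub (x : 'I_n) : bool := (K <= pendants x)%N.

Definition anchor (z : 'I_n) : 'I_n := odflt z [pick u | (0 < G z u)%N].

Lemma adj_closed_full (P : pred 'I_n) x : P x ->
  (forall u v, (0 < G u v)%N -> P u -> P v) -> forall y, P y.
Proof.
move=> Px cl y; have /connectP[p pp ->] := conn x y.
elim: p x Px pp => //= z p IH x Px /andP[xz zp]; apply: IH zp.
exact: cl xz Px.
Qed.

Lemma leaf_anchor z : leaf z -> (0 < G z (anchor z))%N.
Proof.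
move=> /eqP dz; rewrite /anchor; case: pickP => [u //|h0].
by move: dz; rewrite /degree big1// => u _; apply/eqP; rewrite eqn0Ngt h0.
Qed.

Lemma leaf_sum z (F : 'I_n -> R) : leaf z ->
  \sum_(v < n) (G z v)%:R * F v = F (anchor z).
Proof. by move=> lz; apply: sum_degree1; [apply/eqP|apply: leaf_anchor]. Qed.

Lemma leaf_mult z v : leaf z -> G z v = (v == anchor z) :> nat.
Proof.
move=> lz; apply/eqP; rewrite -(eqr_nat R) -(sum_delta R G z v).
by rewrite (leaf_sum (fun w => (w == v)%:R) lz) (eq_sym v).
Qed.

(** Two adjacent leaves form a whole component, against connectedness and [2 < n]. *)
Lemma anchor_core z : leaf z -> ~~ leaf (anchor z).
Proof.
move=> lz; apply/negP => lu.
have zz : anchor (anchor z) = z.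
  have := leaf_anchor lz; rewrite mult_sym leaf_mult//.
  by case: eqP.
have full y : (y == z) || (y == anchor z).
  apply: (@adj_closed_full (fun y => (y == z) || (y == anchor z)) z).
    by rewrite eqxx.
  move=> u v uv /orP[] /eqP uE; move: uv; rewrite uE leaf_mult ?zz//.
    by case: (v == anchor z); rewrite ?orbT.
  by case: (v == z).
have : (#|pred2 z (anchor z)| <= 2)%N by rewrite card2; case: (_ == _).
have : (#|'I_n| <= #|pred2 z (anchor z)|)%N by apply: subset_leq_card; apply/fintype.subsetP => y _; apply: full.
by rewrite card_ord; lia.
Qed.

Lemma degree_core x : ~~ leaf x -> degree G x = (degree core x + pendants x)%N.
Proof.
move=> lx; rewrite /degree (bigID leaf) /= addnC; congr (_ + _)%N.
rewrite [RHS](bigID leaf) /= [X in (_ = X + _)%N]big1 ?add0n.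
  by apply: eq_bigr => y ly; rewrite /core_mult (negbTE lx) (negbTE ly).
by move=> y ly; rewrite /core_mult ly orbT.
Qed.

(** By connectedness [G] is then a star centred at [x], with [n - 1 >= K] leaves. *)
Lemma isolated_hub x : ~~ leaf x -> degree core x = 0%N -> hub x.
Proof.
move=> lx /eqP; rewrite sum_nat_eq0 => /forallP d0.
have full y : (y == x) || (leaf y && (anchor y == x)).
  apply: (@adj_closed_full (fun y => (y == x) || (leaf y && (anchor y == x))) x).
    by rewrite eqxx.
  move=> u v uv /orP[/eqP uE|/andP[lu /eqP au]]; last first.
    by move: uv; rewrite leaf_mult// au; case: eqP.
  move: uv; rewrite uE; case: (boolP (leaf v)) => lv xv.
    by move: xv; rewrite mult_sym leaf_mult// eq_sym; case: eqP; rewrite ?orbT.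
  have := d0 v; rewrite /= /core_mult (negbTE lx) (negbTE lv) /=.
  by move=> /eqP g0; rewrite g0 in xv.
rewrite /hub; apply: (@leq_trans (\sum_(z < n | z != x) 1)%N).
  rewrite sum1_card; have := cardC1 x; rewrite card_ord => c.
  have -> : #|[pred z | z != x]| = n.-1 by rewrite -c; apply: eq_card.
  by lia.
rewrite /pendants big_mkcond [leqRHS]big_mkcond /=; apply: leq_sum => z _.
case: (eqVneq z x) => //= zx.
have := full z; rewrite (negbTE zx) /= => /andP[lz /eqP az].
by rewrite lz mult_sym leaf_mult// az eqxx.
Qed.

(** Pendant edges carry no current under this extension, so it is harmonic at leaves and keeps its
    core Laplacian elsewhere. *)
Definition extend (phi : 'I_n -> R) (v : 'I_n) : R :=
  phi (if leaf v then anchor v else v).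

Lemma lap_extend_leaf phi v : leaf v -> lap G (extend phi) v = 0.
Proof.
move=> lv; rewrite /lap (leaf_sum (fun w => extend phi v - extend phi w) lv).
by rewrite /extend lv (negbTE (anchor_core lv)) subrr.
Qed.

Lemma lap_extend_core phi v : ~~ leaf v -> lap G (extend phi) v = lap core phi v.
Proof.
move=> lv; apply: eq_bigr => w _; rewrite /extend (negbTE lv) /= /core_mult (negbTE lv) /=.
case: ifP => lw //; rewrite mult_sym leaf_mult//.
by case: eqP => [->|_]; rewrite ?subrr ?mulr0 ?mul0r.
Qed.

Lemma sum_leaf_anchor (F : 'I_n -> R) :
  \sum_(z < n | leaf z) F (anchor z) = \sum_(v < n) (pendants v)%:R * F v.
Proof.
transitivity (\sum_(z < n | leaf z) \sum_(v < n) (G z v)%:R * F v).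
  by apply: eq_bigr => z lz; rewrite leaf_sum.
rewrite exchange_big; apply: eq_bigr => v _ /=.
rewrite /pendants natr_sum mulr_suml; apply: eq_bigr => z _.
by rewrite mult_sym.
Qed.

Local Notation lres := (local_res R core hub).
Local Notation pot := (pot R core hub).
Local Notation cond := (conductance R core hub).

Definition base_fun (x v : 'I_n) : R := lres x * extend (pot x) v.

Definition test_fun (x v : 'I_n) : R :=
  if leaf x then (v == x)%:R + base_fun (anchor x) v else base_fun x v.

Lemma extend_pot_ge0 x v : 0 <= extend (pot x) v.
Proof. exact: pot_ge0. Qed.

(** In [\sum_v f v * lap f v] the source contributes [cond x]; the other terms are at most 0 by
    subharmonicity. *)
Lemma energy_extend_pot x : ~~ leaf x -> energy G (extend (pot x)) <= cond x.
Proof.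
move=> lx; rewrite /energy /dirichlet (bigD1 x)//= -[leRHS]addr0 lerD//.
  by rewrite lap_extend_core// lap_pot /extend (negbTE lx) pot_xx mul1r.
apply: sumr_le0 => v vx; case: (boolP (leaf v)) => lv.
  by rewrite lap_extend_leaf// mulr0.
rewrite lap_extend_core// /extend (negbTE lv).
have := pot_ge0 R core hub x v; rewrite le_eqVlt => /predU1P[<-|p0].
  by rewrite mul0r.
by apply: mulr_ge0_le0; [apply: ltW|apply: pot_subharmonic].
Qed.

Lemma base_fun_diag x : ~~ leaf x -> base_fun x x = lres x.
Proof. by move=> lx; rewrite /base_fun /extend (negbTE lx) pot_xx mulr1. Qed.

Lemma energy_base_fun x : ~~ leaf x -> energy G (base_fun x) <= lres x.
Proof.
move=> lx; rewrite energyZ.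
apply: (@le_trans _ _ (lres x ^+ 2 * cond x)).
  by rewrite ler_wpM2l ?sqr_ge0// energy_extend_pot.
rewrite /local_res; case: ifP => _; last by rewrite expr0n mul0r.
have [->|c0] := eqVneq (cond x) 0; first by rewrite mulr0 invr0.
by rewrite expr2 -mulrA mulVf// mulr1.
Qed.

Lemma test_fun_value x : ~~ leaf x ->
  lres x <= 2 * test_fun x x - energy G (test_fun x).
Proof.
move=> lx.
have -> : test_fun x = base_fun x by apply/funext => v; rewrite /test_fun (negbTE lx).
by rewrite base_fun_diag//; have := energy_base_fun lx; lra.
Qed.

(** The indicator function of [z] has energy 1 and is orthogonal to the extended function, which is
    harmonic at [z]; so it adds [2 - 1]. *)
Lemma test_fun_value_leaf z : leaf z ->
  1 + lres (anchor z) <= 2 * test_fun z z - energy G (test_fun z).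
Proof.
move=> lz; have la := anchor_core lz.
have -> : test_fun z = fun v => (v == z)%:R + base_fun (anchor z) v.
  by apply/funext => v; rewrite /test_fun lz.
have dz f : dirichlet G (fun v => (v == z)%:R) f = lap G f z.
  rewrite /dirichlet (bigD1 z)//= eqxx mul1r big1 ?addr0// => v /negbTE ->.
  by rewrite mul0r.
rewrite energyD {1}/energy !dz lapZ lap_extend_leaf// mulr0.
rewrite /lap (leaf_sum (fun w => (z == z)%:R - (w == z)%:R) lz) eqxx.
have -> : anchor z == z = false by apply/negbTE/eqP => e; move: la; rewrite e lz.
rewrite {1}/base_fun {1}/extend lz pot_xx.
by have /= := energy_base_fun la; lra.
Qed.

Lemma lres_le3 x : lres x <= 3.
Proof.
rewrite /local_res; case: ifP => // _.
case: (posnP (degree core x)) => [d0|d0].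
  rewrite /conductance big1 ?invr0// => u _.
  by move: d0 => /eqP; rewrite sum_nat_eq0 => /forallP/(_ u)/eqP ->; rewrite mul0r.
have c0 := conductance_gt0 R hub d0.
rewrite -[leLHS]div1r ler_pdivrMr//.
have := conductance_ge R core hub x.
have : 1 <= (degree core x)%:R :> R by rewrite ler1n.
by lra.
Qed.

(** [57 = 3 * 19]: scale times core mass. Each vertex of the support carries fewer than [K] leaves,
    so its value occurs at most [K] times. *)
Lemma sum_base_fun x : ~~ leaf x -> \sum_(v < n) base_fun x v <= 57 * K%:R.
Proof.
move=> lx; rewrite -mulr_sumr /local_res.
case: ifP => cx; last by rewrite mul0r mulr_ge0.
have -> : (cond x)^-1 = lres x by rewrite /local_res cx.
apply: (@le_trans _ _ (3 * (19 * K%:R))); last by lra.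
apply: ler_pM; rewrite ?local_res_ge0 ?lres_le3//.
  by apply: sumr_ge0 => v _; apply: extend_pot_ge0.
have hubK v : (vclass core hub v <= 6)%N -> (pendants v < K)%N.
  by rewrite /vclass /hub; case: leqP.
apply: (@le_trans _ _ (\sum_(v < n) K%:R * pot x v)); last first.
  rewrite -mulr_sumr mulrC ler_wpM2r// sum_pot// (vclass_degree cx)//.
rewrite (bigID leaf) /= {1}/extend.
under eq_bigr => v lv do rewrite lv.
rewrite sum_leaf_anchor.
apply: (@le_trans _ _ (\sum_(v < n) ((pendants v)%:R * pot x v + pot x v))).
  rewrite big_split lerD// [leRHS](bigID leaf) /= -[leLHS]add0r lerD//.
    by apply: sumr_ge0 => v _; apply: pot_ge0.
  by apply: ler_sum => v lv; rewrite /extend (negbTE lv).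
apply: ler_sum => v _.
have p0 := pot_ge0 R core hub x v.
rewrite -[X in _ + X]mul1r -mulrDl.
move: p0; rewrite le_eqVlt => /predU1P[<-|p0]; first by rewrite !mulr0.
rewrite ler_wpM2r ?(ltW p0)// natr1 ler_nat.
have [->|vx] := eqVneq v x; first exact: hubK.
by apply: hubK; apply: pot_support vx p0.
Qed.

Lemma sum_test_fun x : \sum_(v < n) test_fun x v <= 57 * K%:R + 1.
Proof.
rewrite /test_fun; case: (boolP (leaf x)) => lx; last first.
  by apply: le_trans (sum_base_fun lx) _; rewrite lerDl.
rewrite big_split /= addrC lerD ?sum_base_fun ?anchor_core//.
rewrite (bigD1 x)//= eqxx big1 ?addr0// => v /negbTE -> //.
Qed.

Lemma pendants_leaf x : leaf x -> pendants x = 0%N.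
Proof.
move=> lx; rewrite /pendants big1// => z lz; rewrite mult_sym leaf_mult//.
by case: eqP => // e; move: (anchor_core lz); rewrite -e lx.
Qed.

Lemma sum_pendants : (\sum_(x < n | ~~ leaf x) pendants x = nleaves G)%N.
Proof.
have -> : (\sum_(x < n | ~~ leaf x) pendants x = \sum_(x < n) pendants x)%N.
  rewrite [RHS](bigID leaf) /= [X in (_ = X + _)%N]big1 ?add0n// => x.
  exact: pendants_leaf.
rewrite /pendants exchange_big /= -sum_leaves.
apply: eq_bigr => z /eqP dz; rewrite -[RHS]dz; apply: eq_bigr => x _.
exact: mult_sym.
Qed.

Lemma sum_core1 : \sum_(x < n | ~~ leaf x) 1 = n%:R - (nleaves G)%:R :> R.
Proof.
apply/eqP; rewrite eq_sym subr_eq; apply/eqP.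
rewrite -[n in LHS]card_ord -sum1_card natr_sum (bigID leaf) /= addrC.
congr (_ + _); by rewrite -sum_leaves natr_sum.
Qed.

(** No two leaves are adjacent, so deleting the leaves removes exactly one edge for each. *)
Lemma sum_core_degree :
  \sum_(x < n | ~~ leaf x) (degree core x)%:R =
  2 * (nedges G)%:R - 2 * (nleaves G)%:R :> R.
Proof.
have E : (\sum_(x < n | ~~ leaf x) degree core x + nleaves G + nleaves G
     = (nedges G).*2)%N.
  have E1 : (\sum_(x < n | leaf x) degree G x = nleaves G)%N.
    by rewrite -sum_leaves; apply: eq_bigr => x /eqP.
  have E2 : (\sum_(x < n | ~~ leaf x) degree G x =
      \sum_(x < n | ~~ leaf x) degree core x + nleaves G)%N.
    rewrite -sum_pendants -big_split; apply: eq_bigr => x lx /=.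
    by rewrite degree_core.
  by rewrite -sum_degree [RHS](bigID leaf) /= E1 E2 addnC.
have := congr1 (fun m => m%:R : R) E.
by rewrite -natr_sum !natrD -mul2n natrM; lra.
Qed.

(** Different hubs have disjoint sets of at least [K] leaves. *)
Lemma sum_hub : (K * \sum_(x < n | ~~ leaf x) hub x <= n)%N.
Proof.
apply: (@leq_trans (nleaves G)); last first.
  by rewrite -[leqRHS]card_ord; apply: max_card.
rewrite -sum_pendants big_distrr /=; apply: leq_sum => x _.
by rewrite /hub; case: (leqP K (pendants x)); rewrite ?muln0 ?muln1.
Qed.

Lemma sum_local_res :
  14 / 3 * (n%:R - (nleaves G)%:R)
   - 5 / 3 * (2 * (nedges G)%:R - 2 * (nleaves G)%:R)
   - 14 / 3 * (\sum_(x < n | ~~ leaf x) hub x)%N%:R <=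
  \sum_(x < n | ~~ leaf x) (1 + (pendants x)%:R) * lres x.
Proof.
rewrite -sum_core1 -sum_core_degree natr_sum !mulr_sumr -!sumrB.
pose tr x u := (core x u)%:R * (transfer R core hub u x - transfer R core hub x u).
(* Each transfer occurs with opposite signs at its two ends, and leaves have no core edges. *)
have tr0 : \sum_(x < n | ~~ leaf x) \sum_(u < n) tr x u = 0.
  have -> : \sum_(x < n | ~~ leaf x) \sum_(u < n) tr x u =
      \sum_(x < n) \sum_(u < n) tr x u.
    rewrite [RHS](bigID leaf) /= [X in _ = X + _]big1 ?add0r// => x lx.
    by rewrite big1// => u _; rewrite /tr /= /core_mult lx mul0r.
  set S := LHS; suff : S = - S by lra.
  rewrite {1}/S exchange_big /S -sumrN; apply: eq_bigr => x _.
  by rewrite -sumrN; apply: eq_bigr => u _; rewrite /tr mult_sym -mulrN opprB.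
rewrite -[leRHS]addr0 -[X in _ <= _ + X]tr0 -big_split; apply: ler_sum => x lx /=.
have dx : (0 < degree core x)%N || hub x.
  by case: posnP => //= d0; apply: isolated_hub.
rewrite mulr1; apply: le_trans (local_balance R dx) _.
rewrite lerD2r ler_wpM2r ?local_res_ge0//.
case: eqP => [d1|_]; last by rewrite lerDl.
(* Core degree 1 without being a leaf of [G] means that a leaf is attached, so the weight
   [1 + pendants x] is at least 2. *)
have : (0 < pendants x)%N.
  by have := lx; rewrite {1}/leaf (degree_core lx) d1; case: (pendants x).
by rewrite -(ler_nat R); lra.
Qed.

(** Grouping the leaves by anchor counts [lres x] once for [x] and once for each leaf at [x]; the
    indicator functions contribute 1 per leaf. *)
Lemma sum_test_fun_value :
  (nleaves G)%:R + \sum_(x < n | ~~ leaf x) (1 + (pendants x)%:R) * lres x <=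
  \sum_(x < n) (2 * test_fun x x - energy G (test_fun x)).
Proof.
rewrite [leRHS](bigID leaf) /=.
apply: (@le_trans _ _ (\sum_(z < n | leaf z) (1 + lres (anchor z)) +
   \sum_(x < n | ~~ leaf x) lres x)); last first.
  rewrite lerD//; apply: ler_sum => x lx.
    exact: test_fun_value_leaf.
  exact: test_fun_value.
rewrite big_split /= sum_leaf_anchor -addrA.
have -> : \sum_(z < n | leaf z) 1 = (nleaves G)%:R :> R.
  by rewrite -sum_leaves natr_sum.
rewrite lerD2l.
have -> : \sum_(x < n | ~~ leaf x) (1 + (pendants x)%:R) * lres x =
    \sum_(x < n | ~~ leaf x) (pendants x)%:R * lres x
    + \sum_(x < n | ~~ leaf x) lres x.
  by rewrite -big_split /=; apply: eq_bigr => x _; rewrite mulrDl mul1r addrC.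
rewrite lerD2r [leRHS](bigID leaf) /= lerDr.
by apply: sumr_ge0 => x _; rewrite mulr_ge0 ?local_res_ge0.
Qed.

(** The coefficient of the leaves is [-14/3 + 10/3 + 1 = -1/3]. Hubs cost the term in [n / K], and
    the masses of the test functions cost the last one. *)
Lemma sum_res_bound : (0 < K)%N ->
  2 * n%:R * (14 / 3 * n%:R - 10 / 3 * (nedges G)%:R - (nleaves G)%:R / 3
              - 14 / 3 * (n%:R / K%:R))
   - 4 * n%:R * (57 * K%:R + 1)
  <= \sum_(x < n) \sum_(y < n) res R G x y.
Proof.
move=> K0.
apply: le_trans (sum_res_lower_bound test_fun conn).
apply: lerB; last first.
  rewrite -mulrA ler_wpM2l//.
  apply: (@le_trans _ _ (\sum_(x < n) (57 * K%:R + 1) : R)).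
    by apply: ler_sum => x _; apply: sum_test_fun.
  by rewrite sumr_const card_ord [leRHS]mulr_natl.
rewrite ler_wpM2l ?mulr_ge0//; apply: le_trans sum_test_fun_value.
have := sum_local_res.
have : (\sum_(x < n | ~~ leaf x) hub x)%N%:R <= n%:R / K%:R :> R.
  by rewrite ler_pdivlMr ?ltr0n// -natrM ler_nat mulnC sum_hub.
by lra.
Qed.

End Core.

(** * Average resistance and triangles sharing a vertex *)

Section Averages.
Variables (R : realType) (n : nat) (G : mgraph n).

Definition connected_graph : bool := [forall x, forall y, connect (adj G) x y].

Definition total_res : R := \sum_(x < n) \sum_(y < n) res R G x y.

Lemma connected_graphP : reflect (forall x y, connect (adj G) x y) connected_graph.
Proof. exact: 'forall_forallP. Qed.

Lemma eff_res_ge0 x y : (0 <= eff_res R G x y)%E.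
Proof.
case: (boolP (connect (adj G) x y)) => c.
  by rewrite eff_res_connect// lee_fin res_ge0.
by rewrite /eff_res (negbTE c) leey.
Qed.

Lemma sum_pairs_sym (r : 'I_n -> 'I_n -> R) :
  (forall x, r x x = 0) -> (forall x y, r x y = r y x) ->
  \sum_(x < n) \sum_(y < n) r x y = 2 * \sum_(x < n) \sum_(y < n | (x < y)%N) r x y.
Proof.
move=> r0 rC.
have up : \sum_(x < n) \sum_(y < n | (x < y)%N) r x y =
    \sum_(x < n) \sum_(y < n) if (x < y)%N then r x y else 0.
  by apply: eq_bigr => x _; rewrite big_mkcond.
have down : \sum_(x < n) \sum_(y < n | (x < y)%N) r x y =
    \sum_(x < n) \sum_(y < n) if (y < x)%N then r x y else 0.
  rewrite up exchange_big; apply: eq_bigr => x _; apply: eq_bigr => y _.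
  by rewrite rC.
rewrite mulr2n mulrDl mul1r {1}up down -big_split; apply: eq_bigr => x _ /=.
rewrite -big_split; apply: eq_bigr => y _ /=.
by case: ltngtP => [_|_|/ord_inj ->]; rewrite ?addr0 ?add0r ?r0.
Qed.

Lemma avg_res_connected : connected_graph -> (1 < n)%N ->
  avg_res R G = (total_res / (n%:R * (n%:R - 1)))%:E.
Proof.
move=> /connected_graphP c n1; rewrite /avg_res.
under eq_bigr => x _ do under eq_bigr => y _ do rewrite (eff_res_connect R (c x y)).
under eq_bigr => x _ do rewrite sumEFin.
rewrite sumEFin -EFinM; congr (_%:E).
rewrite /total_res sum_pairs_sym; [|by move=> x; apply: res_xx|by move=> x y; apply: res_sym].
have := mul_bin_diag n 1; rewrite bin1 => /(congr1 (fun m => m%:R : R)).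
rewrite !natrM -subn1 natrB ?(ltnW n1)// => ->.
have : ('C(n, 2))%:R != 0 :> R by rewrite pnatr_eq0 -lt0n bin_gt0.
move=> b0; rewrite invfM mulrACA divff ?pnatr_eq0// mul1r mulrC //.
Qed.

Lemma avg_res'_connected : connected_graph ->
  avg_res' R G = (total_res / n%:R ^+ 2)%:E.
Proof.
move=> /connected_graphP c; rewrite /avg_res'.
under eq_bigr => x _ do under eq_bigr => y _ do rewrite (eff_res_connect R (c x y)).
under eq_bigr => x _ do rewrite sumEFin.
by rewrite sumEFin -EFinM natrX mulrC.
Qed.

Lemma avg_res_disconnected : ~~ connected_graph -> (1 < n)%N -> avg_res R G = +oo%E.
Proof.
move=> /forallPn[x /forallPn[y cxy]] n1; rewrite /avg_res.
suff -> : (\sum_(x < n) \sum_(y < n | (x < y)%N) eff_res R G x y)%E = +oo%E.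
  by rewrite gt0_muley// lte_fin invr_gt0 ltr0n bin_gt0.
have e0 a b : (eff_res R G a b != -oo)%E.
  by apply/eqP => e; have := eff_res_ge0 a b; rewrite e.
have key a b : ~~ connect (adj G) a b -> (a < b)%N ->
    (\sum_(x < n) \sum_(y < n | (x < y)%N) eff_res R G x y)%E = +oo%E.
  move=> cab ab; apply/esum_eqyP.
    move=> i _; apply/eqP => e.
    have : (0 <= \sum_(y < n | (i < y)%N) eff_res R G i y)%E.
      by apply: sume_ge0 => j _; apply: eff_res_ge0.
    by rewrite e.
  exists a; split; rewrite ?mem_index_enum//; apply/esum_eqyP => //.
  exists b; split; rewrite ?mem_index_enum//.
  by rewrite /eff_res (negbTE cab).
case: (ltngtP x y) => [xy|yx|/ord_inj xy]; first exact: key xy.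
  by apply: key yx; rewrite connect_adj_sym.
by move: cxy; rewrite xy connect0.
Qed.

Lemma total_res_ge0 : connected_graph -> 0 <= total_res.
Proof.
move=> /connected_graphP c; apply: sumr_ge0 => x _; apply: sumr_ge0 => y _.
exact: res_ge0.
Qed.

Lemma avg_res'_ge0 : (0 <= avg_res' R G)%E.
Proof.
apply: mule_ge0; first by rewrite lee_fin invr_ge0.
by apply: sume_ge0 => x _; apply: sume_ge0 => y _; apply: eff_res_ge0.
Qed.

Lemma total_res_div_le : connected_graph -> (1 < n)%N ->
  total_res / n%:R ^+ 2 <= total_res / (n%:R * (n%:R - 1)).
Proof.
move=> c n1; have n2 : (2 : R) <= n%:R by rewrite ler_nat.
rewrite ler_wpM2l ?total_res_ge0// lef_pV2 ?posrE; [|nra|nra].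
by nra.
Qed.

End Averages.

(** * The extremal example: triangles and pendant edges at one vertex *)

Section Triangles.
Variables (R : realType) (m t : nat).
Hypothesis t_small : (2 * t <= m)%N.
Local Notation n := m.+1.

(* A triangle at the hub [0] has the two other vertices [i] and [t + i]. *)
Definition partner (k : nat) : nat := if (k <= t)%N then (k + t)%N else (k - t)%N.

Definition paired (x : nat) : bool := (0 < x <= 2 * t)%N.

Definition tri_mult (x y : 'I_n) : nat :=
  (((x == 0 :> nat) != (y == 0 :> nat)) +
   (paired x && (y == partner x :> nat)))%N.

Lemma paired_partner x : paired x -> paired (partner x) /\ partner (partner x) = x.
Proof.
rewrite /paired /partner => px; case: (leqP x t) => h.
  by rewrite ifN; lia.
by rewrite ifT; lia.
Qed.

Lemma partner_neq x : paired x -> partner x != x.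
Proof. by rewrite /paired /partner => px; case: (leqP x t) => h; apply/eqP; lia. Qed.

Lemma partner_lt x : paired x -> (partner x < n)%N.
Proof. by move=> /paired_partner[]; rewrite /paired; lia. Qed.

Lemma tri_mult_sym x y : tri_mult x y = tri_mult y x.
Proof.
rewrite /tri_mult eq_sym; congr (_ + nat_of_bool _)%N.
by apply/idP/idP => /andP[/paired_partner[p1 p2] /eqP e]; rewrite e p1 p2 eqxx.
Qed.

Lemma tri_mult_irr x : tri_mult x x = 0%N.
Proof.
rewrite /tri_mult eqxx add0n; case: (boolP (paired x)) => //= px.
by rewrite eq_sym (negbTE (partner_neq px)).
Qed.

Definition tri_graph : mgraph n := MGraph tri_mult_sym tri_mult_irr.

Lemma tri_sum (v : 'I_n) (F : 'I_n -> R) : v != ord0 ->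
  \sum_(w < n) (tri_graph v w)%:R * F w =
  F ord0 + if paired v then F (inord (partner v)) else 0.
Proof.
move=> v0; have v0' : (v == 0 :> nat) = false by apply/negbTE; apply: contra v0.
under eq_bigr => w _ do rewrite /= /tri_mult v0' natrD mulrDl.
rewrite big_split /=; congr (_ + _).
  rewrite (bigD1 ord0)//= mul1r big1 ?addr0// => w w0.
  have -> : (w == 0 :> nat) = false by apply/negbTE; apply: contra w0.
  by rewrite mul0r.
case: ifP => pv; last by rewrite big1// => w _; rewrite mul0r.
have E (w : 'I_n) : (w == partner v :> nat) = (w == inord (partner v)).
  apply/eqP/eqP => [e|->]; last by rewrite inordK// partner_lt.
  by apply: val_inj; rewrite /= inordK// partner_lt.
rewrite (bigD1 (inord (partner v)))//= E eqxx mul1r big1 ?addr0// => w wp.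
by rewrite E (negbTE wp) mul0r.
Qed.

Lemma tri_connected : connected_graph tri_graph.
Proof.
have c0 x : connect (adj tri_graph) ord0 x.
  case: (eqVneq x ord0) => [->|x0]; first exact: connect0.
  apply: connect1; rewrite /adj /= /tri_mult /=.
  by have -> : (x == 0 :> nat) = false by apply/negbTE; apply: contra x0.
apply/connected_graphP => x y; apply: connect_trans (c0 y).
by rewrite connect_adj_sym.
Qed.

(** Resistance from [x] to the hub; in a triangle, 1 and 2 in parallel give 2/3. *)
Definition tri_res (x : nat) : R :=
  if x == 0%N then 0 else if paired x then 2 / 3 else 1.

Definition tri_pot (x v : 'I_n) : R :=
  if v == x then tri_res x
  else if paired x && (v == inord (partner x)) then 1 / 3 else 0.

Lemma tri_pot_ge0 x v : 0 <= tri_pot x v.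
Proof.
rewrite /tri_pot /tri_res; case: ifP => _; [case: ifP => _; [|case: ifP => _]|case: ifP => _]; lra.
Qed.

Lemma tri_pot_unit x : unit_potential tri_graph x ord0 (tri_pot x).
Proof.
have away v : v != ord0 -> lap tri_graph (tri_pot x) v = (v == x)%:R.
  move=> v0; rewrite lapE natr_degree.
  under eq_bigr => w _ do rewrite -[(tri_graph v w)%:R]mulr1.
  rewrite (tri_sum (fun=> 1) v0) (tri_sum _ v0).
  have p0 : tri_pot x ord0 = 0.
    rewrite /tri_pot /tri_res; case: eqVneq => [<-//|x0].
    case: (boolP (paired x)) => //= px.
    case: eqP => // /(congr1 val) /=; rewrite inordK ?partner_lt// => e.
    by have [] := paired_partner px; rewrite /paired -e.
  rewrite p0.
  have v0' : (v == 0 :> nat) = false by apply/negbTE; apply: contra v0.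
  case: (boolP (paired v)) => pv; last first.
    rewrite /tri_pot; case: (eqVneq v x) => [vx|vx].
      by rewrite -vx /tri_res v0' (negbTE pv) /=; lra.
    case: (boolP (paired x)) => //= px; last by lra.
    case: eqP => [e|_] /=; last by lra.
    move: pv; rewrite e inordK ?partner_lt//.
    by have [-> _] := paired_partner px.
  have [pp ppv] := paired_partner pv.
  have pvK : partner (inord (partner v) : 'I_n) = v by rewrite inordK ?partner_lt.
  rewrite /tri_pot; case: (eqVneq v x) => [vx|vx].
    rewrite -vx pv /= eqxx /tri_res v0' pv.
    case: eqP => [/(congr1 val)/=|_]; last by rewrite /=; lra.
    by rewrite inordK ?partner_lt// => /eqP; rewrite (negbTE (partner_neq pv)).
  case: (eqVneq (inord (partner v)) x) => [px|px].
    have pxx : paired x by rewrite -px inordK ?partner_lt.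
    rewrite pxx /= /tri_res pxx.
    have -> : v == inord (partner x) by rewrite -px pvK inord_val.
    have -> : (x == 0 :> nat) = false by apply/negbTE; move: pxx; rewrite /paired; lia.
    by rewrite /=; lra.
  case: (boolP (paired x)) => //= pxx; last by lra.
  have -> : (v == inord (partner x)) = false.
    apply/negbTE/eqP => e; move/eqP: px; apply.
    apply: val_inj; rewrite /= e !inordK ?partner_lt//; last first.
      by have [] := paired_partner pxx.
    by have [] := paired_partner pxx.
  case: eqP => [e|_]; last by lra.
  move/eqP: vx; case; apply: val_inj; rewrite /=.
  have := congr1 val e; rewrite /= !inordK ?partner_lt// => e'.
  by rewrite -ppv e'; have [] := paired_partner pxx.
move=> v; rewrite -/(lap tri_graph (tri_pot x) v).
case: (eqVneq v ord0) => [->|v0]; last by rewrite away// subr0.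
(* The node law at the hub follows from the others, since the Laplacian sums to 0. *)
have : \sum_(v < n) lap tri_graph (tri_pot x) v = 0.
  transitivity (dirichlet tri_graph (fun=> 1) (tri_pot x)).
    by apply: eq_bigr => w _; rewrite mul1r.
  rewrite dirichletC /dirichlet big1// => w _.
  by rewrite /lap big1 ?mulr0// => z _; rewrite subrr mulr0.
rewrite (bigD1 ord0)//= (eq_bigr (fun w => (w == x)%:R)) => [|w w0]; last exact: away.
move/eqP; rewrite addr_eq0 => /eqP ->.
case: (eqVneq x ord0) => [->|x0].
  by rewrite ?eqxx big1 ?subrr ?oppr0// => w /negbTE ->.
rewrite ?(eq_sym ord0 x) ?(negbTE x0) ?eqxx (bigD1 x)//= eqxx big1 ?addr0 ?sub0r//.
by move=> w /andP[_ /negbTE ->].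
Qed.

(** Superposition through the hub: [tri_pot x - tri_pot y] is a potential for [x] and [y], and the
    dropped cross values are nonnegative. *)
Lemma tri_res_le x y : res R tri_graph x y <= tri_res x + tri_res y.
Proof.
have /connected_graphP c := tri_connected.
rewrite (@resE _ _ _ _ _ (fun v => tri_pot x v - tri_pot y v) (c x y)).
  have E z : tri_pot z z = tri_res z by rewrite /tri_pot eqxx.
  by rewrite !E; have := tri_pot_ge0 x y; have := tri_pot_ge0 y x; lra.
move=> v; rewrite -/(lap tri_graph _ v) lapB /lap !tri_pot_unit.
by ring.
Qed.

Lemma sum_paired k : (\sum_(i < k) paired i = minn k.-1 (2 * t))%N.
Proof.
elim: k => [|k IH]; first by rewrite big_ord0 min0n.
by rewrite big_ord_recr /= IH /paired; case: k {IH} => [|k] /=; lia.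
Qed.

Lemma sum_tri_res : \sum_(x < n) tri_res x = m%:R - 2 / 3 * t%:R.
Proof.
have E (x : 'I_n) : tri_res x = 1 - (x == ord0)%:R - 1 / 3 * (paired x)%:R.
  rewrite /tri_res; case: (eqVneq x ord0) => [->|x0] /=; first by lra.
  have -> : (x == 0 :> nat) = false by apply/negbTE; apply: contra x0.
  by case: (paired x) => /=; lra.
under eq_bigr do rewrite E.
rewrite !sumrB -mulr_sumr sumr_const card_ord.
have -> : \sum_(i < n) (i == ord0)%:R = 1 :> R.
  by rewrite (bigD1 ord0)//= big1 ?addr0// => i /negbTE ->.
by rewrite -natr_sum sum_paired (minn_idPr t_small) natrM -natr1; lra.
Qed.

Lemma tri_nedges : nedges tri_graph = (m + t)%N.
Proof.
suff : (nedges tri_graph)%:R = (m + t)%:R :> R by move/eqP; rewrite eqr_nat => /eqP.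
have : (\sum_(x < n) degree tri_graph x)%:R = 2 * (m + t)%:R :> R.
  have E (x : 'I_n) : x != ord0 -> (degree tri_graph x)%:R = 1 + (paired x)%:R :> R.
    move=> x0; rewrite natr_degree.
    under eq_bigr => w _ do rewrite -[(tri_graph x w)%:R]mulr1.
    by rewrite (tri_sum (fun=> 1) x0); case: (paired x).
  have D0 : (degree tri_graph ord0)%:R = m%:R :> R.
    rewrite /degree (bigD1 ord0)//= tri_mult_irr add0n.
    rewrite (eq_bigr (fun=> 1%N)); last first.
      move=> i i0; rewrite /tri_mult /=.
      by have -> : (i == 0 :> nat) = false by apply/negbTE; apply: contra i0.
    by rewrite sum1_card cardC1 card_ord.
  rewrite natr_sum (bigD1 ord0)//= D0 (eq_bigr _ E) big_split /=.
  have -> : \sum_(i < n | i != ord0) (paired i)%:R = (2 * t)%:R :> R.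
    have := sum_paired n; rewrite (bigD1 ord0)//= add0n (minn_idPr t_small) => <-.
    by rewrite natr_sum.
  rewrite sumr_const cardC1 card_ord /= natrD natrM; lra.
by rewrite sum_degree -mul2n natrM; lra.
Qed.

(** With [S] the sum of [tri_res], all pairs give [2 n S]; the zero diagonal saves [2 S], leaving
    [2 m S]. *)
Lemma tri_total : total_res R tri_graph <= 2 * m%:R * (m%:R - 2 / 3 * t%:R).
Proof.
have -> : 2 * m%:R * (m%:R - 2 / 3 * t%:R) =
  \sum_(x < n) \sum_(y < n) (tri_res x + tri_res y - (x == y)%:R * (2 * tri_res x)) :> R.
  have -> : \sum_(x < n) \sum_(y < n)
     (tri_res x + tri_res y - (x == y)%:R * (2 * tri_res x)) =
     \sum_(x < n) (n%:R * tri_res x + (m%:R - 2 / 3 * t%:R) - 2 * tri_res x).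
    apply: eq_bigr => x _; rewrite sumrB big_split /= sumr_const card_ord sum_tri_res.
    rewrite [X in _ = X + _ - _]mulr_natl; congr (_ - _).
    rewrite (bigD1 x)//= eqxx mul1r big1 ?addr0// => y yx.
    by rewrite eq_sym (negbTE yx) mul0r.
  rewrite sumrB big_split /= -!mulr_sumr sum_tri_res sumr_const card_ord.
  by rewrite -[X in _ + X - _]mulr_natl -natr1; ring.
apply: ler_sum => x _; apply: ler_sum => y _.
case: eqVneq => [->|xy]; last by rewrite mul0r subr0 tri_res_le.
by rewrite res_xx mul1r; lra.
Qed.

End Triangles.

(** * Asymptotics *)

Lemma nat_above (R : realType) (x : R) : exists k : nat, (0 < k)%N /\ x <= k%:R.
Proof.
exists (Num.bound `|x|).+1; split => //.
apply: le_trans (ler_norm x) _; apply: le_trans (ltW (archi_boundP (normr_ge0 x))) _.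
by rewrite ler_nat.
Qed.

Section Asymptotics.
Variables (R : realType) (eps alpha : R).

Local Notation value := (11 / 6 + 2 / 3 * eps).

(** Inserting [e <= (9/8 - eps/2) n] into [sum_res_bound] gives [11/6 + 10/3 eps - 2/3 L/n] up to
    the error terms, with [L] the number of leaves. *)
Lemma lower_bound (delta : R) : alpha = 9 / 4 - eps -> 0 < delta ->
  exists n0 : nat, forall n, (n0 <= n)%N -> forall G : mgraph n,
    connected_graph G -> has_avg_degree alpha G ->
    value + 8 / 3 * (eps - (nleaves G)%:R / (4 * n%:R)) - delta
      <= total_res R G / n%:R ^+ 2.
Proof.
move=> halpha d0.
(* This [K] makes the hub error [28 / (3 K)] at most [delta / 2]; then [N] does the same for the
   mass error [4 (57 K + 1) / n]. *)
have [K [K0 hK]] := nat_above (56 / 3 / delta).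
have [N [_ hN]] := nat_above (8 * (57 * K%:R + 1) / delta).
exists (maxn 3 (maxn K.+1 N)) => n; rewrite !geq_max => /and3P[n3 Kn Nn] G.
move=> /connected_graphP conn; rewrite /has_avg_degree halpha => he.
have S := sum_res_bound R conn n3 Kn K0; rewrite -/(total_res R G) in S.
have n0 : (0 : R) < n%:R by rewrite ltr0n (ltn_trans _ n3).
have K0' : (0 : R) < K%:R by rewrite ltr0n.
rewrite ler_pdivlMr ?exprn_gt0//; apply: le_trans S.
have h1 : n%:R / K%:R <= delta * n%:R * (3 / 56).
  rewrite ler_pdivrMr//; move: hK; rewrite ler_pdivrMr// => hK.
  by nra.
have h2 : 8 * (57 * K%:R + 1) <= delta * n%:R.
  move: hN; rewrite ler_pdivrMr// [_ * delta]mulrC => hN; apply: le_trans hN _.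
  by rewrite ler_pM2l// ler_nat.
have h3 : (nleaves G)%:R / (4 * n%:R) * n%:R ^+ 2 = (nleaves G)%:R * n%:R / 4 :> R.
  by field; rewrite gt_eqF.
have -> : (value + 8 / 3 * (eps - (nleaves G)%:R / (4 * n%:R)) - delta) * n%:R ^+ 2 =
   (value + 8 / 3 * eps - delta) * n%:R ^+ 2
   - 8 / 3 * ((nleaves G)%:R / (4 * n%:R) * n%:R ^+ 2) by ring.
rewrite h3.
have h1' := ler_wpM2l (ltW n0) h1; have h2' := ler_wpM2l (ltW n0) h2.
have he' := ler_wpM2l (ltW n0) he.
by lra.
Qed.

Lemma upper_bound (delta : R) :
  0 < eps -> eps <= 1 / 4 -> alpha = 9 / 4 - eps -> 0 < delta ->
  exists n0 : nat, forall n, (n0 <= n)%N -> exists G : mgraph n,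
    [/\ connected_graph G, has_avg_degree alpha G &
        total_res R G / (n%:R * (n%:R - 1)) <= value + delta].
Proof.
move=> heps0 heps1 halpha d0.
(* Rounding the number of triangles down costs at most 4/3 in [2 (m - 2/3 t)], absorbed by
   [delta * n]. *)
have [N [_ hN]] := nat_above (4 / 3 / delta).
exists (maxn 2 N) => n; rewrite geq_max => /andP[n2 Nn].
have {}hN : 4 / 3 <= delta * n%:R.
  move: hN; rewrite ler_pdivrMr// [_ * delta]mulrC => hN; apply: le_trans hN _.
  by rewrite ler_pM2l// ler_nat.
case: n n2 Nn hN => // m n2 _ hN.
have m1 : (1 : R) <= m%:R by rewrite ler1n; lia.
have nE : m.+1%:R = m%:R + 1 :> R by rewrite natr1.
have a0 : 0 <= 1 / 8 - eps / 2 by lra.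
(* The edge budget [(9/8 - eps/2) n] minus [n]: what is left for triangles besides the star at the
   hub. *)
pose r : R := (1 / 8 - eps / 2) * m.+1%:R.
have r0 : 0 <= r by rewrite mulr_ge0.
have /andP[tr rt] := truncn_itv r0.
set t := Num.truncn r in tr rt.
have t_small : (2 * t <= m)%N.
  rewrite -(ler_nat R) natrM; move: tr; rewrite /r nE => tr.
  have : eps * (m%:R + 1) >= 0 by rewrite mulr_ge0 ?ltW ?addr_gt0 //; lra.
  by lra.
exists (tri_graph t_small); split.
- exact: tri_connected.
- rewrite /has_avg_degree (tri_nedges R) natrD halpha; move: tr.
  by rewrite /r nE; lra.
have S := tri_total R t_small.
have tE : t.+1%:R = t%:R + 1 :> R by rewrite natr1.
move: hN rt; rewrite /r !nE tE addrK => hN rt.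
rewrite ler_pdivrMr; last by rewrite mulr_gt0; lra.
apply: le_trans S _.
have : m%:R * (2 * (m%:R - 2 / 3 * t%:R)) <= m%:R * ((value + delta) * (m%:R + 1)).
  by rewrite ler_wpM2l; lra.
by lra.
Qed.

Lemma min_res_ge0 n : (0 <= min_res alpha n)%E.
Proof. by apply: le_ereal_inf_tmp => _ [G _ <-]; apply: avg_res'_ge0. Qed.

Lemma min_res_le (delta : R) :
  0 < eps -> eps <= 1 / 4 -> alpha = 9 / 4 - eps -> 0 < delta ->
  exists n0 : nat, forall n, (n0 <= n)%N ->
    (min_res alpha n <= (value + delta)%:E)%E.
Proof.
move=> h0 h1 h2 /(upper_bound h0 h1 h2)[n0 hn0]; exists (maxn 2 n0) => n; rewrite geq_max => /andP[n2 nn].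
have [G [c hG le]] := hn0 n nn.
apply: (@le_trans _ _ (avg_res' R G)).
  by apply: ereal_inf_lbound; exists G.
rewrite avg_res'_connected// lee_fin; apply: le_trans le.
exact: total_res_div_le.
Qed.

(* If the limit defining [lim_res] does not exist, [lim_res] takes the default
   value [0], for which both properties hold as well. *)
Lemma lim_resP : 0 < eps -> eps <= 1 / 4 -> alpha = 9 / 4 - eps ->
  exists2 l : R, lim_res alpha = l%:E &
  l <= value /\ forall delta : R, 0 < delta ->
    exists n0 : nat, forall n, (n0 <= n)%N -> ((l - delta)%:E <= min_res alpha n)%E.
Proof.
move=> heps0 heps1 halpha.
case: (pselect (cvgn (min_res alpha))) => [cv|dv]; last first.
  exists 0; first exact: dvgP dv.
  split; first by lra.
  move=> delta d0; exists 0%N => n _; apply: le_trans (min_res_ge0 n).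
  by rewrite lee_fin; lra.
have l0 : (0 <= lim_res alpha)%E by apply: lime_ge => //; apply: nearW => n; apply: min_res_ge0.
have lle (delta : R) : 0 < delta -> (lim_res alpha <= (value + delta)%:E)%E.
  move=> /(min_res_le heps0 heps1 halpha)[n0 hn0]; apply: lime_le => //.
  by exists n0 => // n /= ?; apply: hn0.
have : (lim_res alpha < +oo)%E by apply: le_lt_trans (lle 1 ltr01) _; rewrite ltry.
move: cv; rewrite /lim_res; set L := limn _ => cv Loo.
have LE : L = (fine L)%:E.
  by rewrite fineK// ge0_fin_numE.
exists (fine L) => //; split.
  by apply/ler_addgt0Pr => delta d0; rewrite -lee_fin -LE; apply: lle.
move=> delta d0.
have /fine_cvgP[[n1 _ h1] h2] : (min_res alpha n @[n --> \oo] --> (fine L)%:E)%classic.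
  by rewrite -LE.
have lt : fine L - delta < fine L by lra.
have [n2 _ h3] := cvgr_ge (fine L) h2 _ lt.
exists (maxn n1 n2) => n; rewrite geq_max => /andP[nn1 nn2].
by rewrite -(fineK (h1 n nn1)) lee_fin; apply: h3.
Qed.

End Asymptotics.

(** * Comparison of the lower bound with the limit and with the example *)

Theorem theorem15 (R : realType) (eps alpha : R)
    (heps0 : 0 < eps) (heps1 : eps <= 1 / 4)
    (halpha : alpha = 9 / 4 - eps) :
  (forall delta : R, 0 < delta ->
     exists n0 : nat, forall n : nat, (n0 <= n)%N ->
       forall (G : mgraph n) (gamma : R),
         has_avg_degree alpha G ->
         (nleaves G)%:R = gamma * n%:R ->
         ((2 / 25 * (eps - gamma / 4) - delta)%:E
            <= avg_res R G - lim_res alpha)%E)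
  /\
  (forall G : forall n : nat, mgraph n,
     (forall n : nat, (2 <= n)%N -> minimises_avg_res alpha (G n)) ->
     forall delta : R, 0 < delta ->
       exists n0 : nat, forall n : nat, (n0 <= n)%N ->
         4 * eps * n%:R - delta * n%:R <= (nleaves (G n))%:R).
Proof.
split.
- move=> delta d0.
  have [l -> [lle lmin]] := lim_resP heps0 heps1 halpha.
  have [n1 lb] := lower_bound halpha d0.
  have [n2 mb] := lmin delta d0.
  exists (maxn 2 (maxn n1 n2)) => n; rewrite !geq_max => /and3P[n_gt1 nn1 nn2] G gamma hG hL.
  case: (boolP (connected_graph G)) => c; last first.
    by rewrite avg_res_disconnected// addye// leey.
  have n0 : (n%:R : R) != 0 by rewrite pnatr_eq0; lia.
  rewrite avg_res_connected// -EFinB lee_fin.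
  have le := total_res_div_le R c n_gt1.
  have := lb n nn1 G c hG; rewrite hL.
  have -> : gamma * n%:R / (4 * n%:R) = gamma / 4 by field.
  (* If [eps - gamma/4 >= 0], the stronger factor 8/3 suffices. Otherwise the claimed bound is below
     [-delta], and [A >= A' >= min_res] is enough. *)
  case: (lerP (gamma / 4) eps) => hg LB; first by lra.
  have : (min_res alpha n <= avg_res' R G)%E by apply: ereal_inf_lbound; exists G.
  rewrite avg_res'_connected// => /(le_trans (mb n nn2)); rewrite lee_fin.
  by lra.
- move=> G hmin delta d0; have d3 : 0 < delta / 3 by lra.
  have [n1 lb] := lower_bound halpha d3.
  have [n2 ub] := upper_bound heps0 heps1 halpha d3.
  exists (maxn 2 (maxn n1 n2)) => n; rewrite !geq_max => /and3P[n_gt1 nn1 nn2].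
  have [hG min] := hmin n n_gt1.
  have [H [cH hH UB]] := ub n nn2.
  have := min H hH; rewrite (avg_res_connected R cH n_gt1).
  (* A disconnected minimiser would have infinite average resistance, while that of [H] is
     finite. *)
  case: (boolP (connected_graph (G n))) => c; last first.
    by rewrite avg_res_disconnected// leye_eq.
  rewrite avg_res_connected// lee_fin => minle.
  have le := total_res_div_le R c n_gt1.
  have LB := lb n nn1 (G n) c hG.
  have n0 : 0 < n%:R :> R by rewrite ltr0n (ltn_trans _ n_gt1).
  (* The two errors [delta / 3] add up to [8/3 * (delta / 4)]. *)
  have : eps - (nleaves (G n))%:R / (4 * n%:R) <= delta / 4 by lra.
  rewrite lerBlDr -lerBlDl ler_pdivlMr; last by rewrite mulr_gt0.
  by lra.
Qed.
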